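(* Let $\Gamma$ be a finite group and let $C_{\rho^+,\rho^-}$ be the conjugacy class of $H\Gamma_n=(\Gamma\times\mathbb Z_2)^n\rtimes S_n$ consisting of the elements of type $(\rho^+,\rho^-)$. Then $C_{\rho^+,\rho^-}$ splits (with respect to the double cover $\theta_n:\widetilde{H\Gamma}_n\to H\Gamma_n$) if and only if: (1) in case $C_{\rho^+,\rho^-}$ is even: $\rho^+\in\mathcal{OP}_n(\Gamma_* )$ and $\rho^-=\emptyset$; (2) in case $C_{\rho^+,\rho^-}$ is odd: $\rho^+=\emptyset$ and $\rho^-\in\mathcal{SP}^-_n(\Gamma_* )$.
   Context: Group. $\Pi_n$ is the group generated by $a_1,\dots,a_n$ and a central element $z$ with relations $a_i^2=z$, $z^2=1$, $a_ia_j=za_ja_i$ ($i\ne j$). $S_n$ acts on $\Pi_n$ by $s(a_i)=a_{s(i)}$, $s(z)=z$, and on $\Gamma^n$ by $s(g_1,\dots,g_n)=(g_{s^{-1}(1)},\dots,g_{s^{-1}(n)})$. Put $\widetilde{H\Gamma}_n=(\Gamma^n\times\Pi_n)\rtimes S_n$, with elements $(g,as)$ ($g\in\Gamma^n$, $a\in\Pi_n$, $s\in S_n$) and product $(g,as)(h,bt)=(g\,s(h),\,a\,s(b)\,st)$. The quotient $\theta_n:\widetilde{H\Gamma}_n\to\widetilde{H\Gamma}_n/\{1,z\}=H\Gamma_n=(\Gamma\times\mathbb Z_2)^n\rtimes S_n$ sends $a_i$ to $b_i$, the generator of the $i$-th copy of $\mathbb Z_2$. For $I=\{i_1,\dots,i_m\}$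 write $b_I=b_{i_1}\cdots b_{i_m}$. The parity $p$ is the homomorphism to $\mathbb Z_2$ with $p(a_i)=1$ (or $p(b_i)=1$) and $p=0$ on $S_n$, $\Gamma^n$; elements are even or odd accordingly, and a conjugacy class is even (odd) if its elements are. Splitting. An element $x\in\widetilde{H\Gamma}_n$ is split if it is not conjugate to $zx$. A conjugacy class $C$ of $H\Gamma_n$ splits if $\theta_n^{-1}(C)$ is the union of two conjugacy classes of $\widetilde{H\Gamma}_n$, equivalently if $\theta_n^{-1}(C)$ consists of split elements. Types. $\Gamma_*$ is the set of conjugacy classes of $\Gamma$. For $(g,b_Is)\in H\Gamma_n$ write $s=s_1\cdots s_k$ as a product of disjoint cycles (including 1-cycles) and $b_Is=(b_{I_1}s_1)\cdots(b_{I_k}s_k)$ with $I_a\subset \mathrm{supp}(s_a)$. If $s_a=(j_1\cdots j_m)$, its signed cycle-product is $g_{j_m}g_{j_{m-1}}\cdots g_{j_1}$ with sign $(-1)^{|I_a|}$. Let $m_i^{\pm}(c)$ be the number of cycles of length $i$ whose signed cycle-product lies in $c\in\Gamma_*$ and has sign $\pm$. The type of the element is $(\rho^+,\rho^-)$, where $\rho^{\pm}(c)$ is the partition $(i^{m_i^\pm(c)})_{i\ge1}$. Two elements of $H\Gamma_n$ are conjugate iff they have the same type. Partitions. A partition-valued function on a finite set $X$ is $\rho=(\rho(x))_{x\in X}$, each $\rho(x)$ a partition; $\|\rho\|=\sum_x|\rho(x)|$ and $l(\rho)=\sum_x l(\rho(x))$ is the total number of parts. $\mathcal{OP}_n(X)$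 is the set of those with $\|\rho\|=n$ and all parts of all $\rho(x)$ odd. $\mathcal{SP}_n(X)$ is the set of those with $\|\rho\|=n$ and each $\rho(x)$ strict (distinct parts). $\mathcal{SP}_n^-(X)$ is the set of $\rho\in\mathcal{SP}_n(X)$ with $l(\rho)$ odd. *)

(* Defs.v *)
From HB Require Import structures.
From mathcomp Require Import all_boot all_order all_algebra all_fingroup.
From mathcomp Require Import ring.

Set Implicit Arguments.
Unset Strict Implicit.
Unset Printing Implicit Defensive.

Local Open Scope group_scope.

(* The element (u, c) stands for z^c * \prod_(i < n) a_i^(u_i), the product
   being taken in increasing order of i.  The presentation of Pi_n is lemmas
   Pin_aa, Pin_zz, Pin_za, Pin_comm, pin_lift_morph, pin_lift_a, pin_lift_z and
   Pin_lift_uniq. *)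
Record Pin (n : nat) := PinElt { pin_vec : {ffun 'I_n -> 'Z_2}; pin_sgn : 'Z_2 }.

Section Pin.
Variable n : nat.
Implicit Types (u v w : {ffun 'I_n -> 'Z_2}) (x y : Pin n).

Definition pin_to x := (pin_vec x, pin_sgn x).
Definition pin_of p : Pin n := PinElt p.1 p.2.
Lemma pin_toK : cancel pin_to pin_of. Proof. by case. Qed.

HB.instance Definition _ := Finite.copy (Pin n) (can_type pin_toK).

(* Moving a_j from the right past a_i contributes one factor z when j < i, and
   a_i a_i = z. *)
Definition pin_form u v : 'Z_2 :=
  (\sum_(i < n) \sum_(j < n | (j <= i)%N) u i * v j)%R.

Definition pin_mul x y : Pin n :=
  PinElt (pin_vec x + pin_vec y)%R
    (pin_sgn x + pin_sgn y + pin_form (pin_vec x) (pin_vec y))%R.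
Definition pin_one : Pin n := PinElt 0%R 0%R.
Definition pin_inv x : Pin n :=
  PinElt (- pin_vec x)%R (- pin_sgn x + pin_form (pin_vec x) (pin_vec x))%R.

Lemma pin_formDl u v w : (pin_form (u + v) w = pin_form u w + pin_form v w)%R.
Proof.
rewrite /pin_form -big_split; apply: eq_bigr => i _ /=.
by rewrite -big_split; apply: eq_bigr => j _; rewrite ffunE GRing.mulrDl.
Qed.

Lemma pin_formDr u v w : (pin_form u (v + w) = pin_form u v + pin_form u w)%R.
Proof.
rewrite /pin_form -big_split; apply: eq_bigr => i _ /=.
by rewrite -big_split; apply: eq_bigr => j _; rewrite ffunE GRing.mulrDr.
Qed.

Lemma pin_form0l u : pin_form 0%R u = 0%R.
Proof.
by rewrite /pin_form big1 // => i _; rewrite big1 // => j _; rewrite ffunE GRing.mul0r.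
Qed.

Lemma pin_formNl u v : (pin_form (- u) v = - pin_form u v)%R.
Proof.
by apply/eqP; rewrite -GRing.subr_eq0 GRing.opprK -pin_formDl GRing.addNr pin_form0l.
Qed.

Lemma pin_mulA : associative pin_mul.
Proof.
move=> [u c] [v d] [w e]; rewrite /pin_mul /= pin_formDl pin_formDr.
by congr PinElt; [rewrite GRing.addrA | ring].
Qed.

Lemma pin_mul1 : left_id pin_one pin_mul.
Proof. by case=> u c; rewrite /pin_mul /= pin_form0l !GRing.add0r GRing.addr0. Qed.

Lemma pin_mulV : left_inverse pin_one pin_inv pin_mul.
Proof.
case=> u c; rewrite /pin_mul /= pin_formNl; congr PinElt; first exact: GRing.addNr.
by rewrite GRing.addrAC GRing.addrK GRing.addNr.
Qed.

HB.instance Definition _ := Finite_isGroup.Build (Pin n) pin_mulA pin_mul1 pin_mulV.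

Definition pin_a (i : 'I_n) : Pin n := PinElt [ffun j => (j == i)%:R%R] 0%R.
Definition pin_z : Pin n := PinElt 0%R 1%R.

Lemma pinM x y : x * y = pin_mul x y. Proof. by []. Qed.
Lemma pin1 : 1 = pin_one. Proof. by []. Qed.

Lemma pin_form_sum_supp u v :
  (forall i j : 'I_n, (j <= i)%N -> (u i * v j = 0)%R) -> pin_form u v = 0%R.
Proof. by move=> h; rewrite /pin_form big1 // => i _; rewrite big1 // => j /h. Qed.

Lemma pin_form_a i j :
  pin_form (pin_vec (pin_a i)) (pin_vec (pin_a j)) = (j <= i)%:R%R.
Proof.
rewrite /pin_form (bigD1 i) //= [X in (_ + X)%R]big1 ?GRing.addr0; last first.
  move=> k /negPf nk; rewrite big1 // => l _.
  by rewrite !ffunE nk GRing.mul0r.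
case: leqP => ji.
  rewrite (bigD1 j) //= !ffunE !eqxx GRing.mul1r big1 ?GRing.addr0 //.
  by move=> k /andP[_ /negPf nk]; rewrite !ffunE nk GRing.mulr0.
rewrite big1 // => k ki; rewrite !ffunE; case: (k =P j) => [kj|]; last by rewrite GRing.mulr0.
by rewrite -kj ltnNge ki in ji.
Qed.

Lemma Z2_addxx (c : 'Z_2) : (c + c = 0)%R.
Proof. by apply/val_inj; case: c => [[|[|]]]. Qed.

Lemma Pin_aa i : pin_a i * pin_a i = pin_z.
Proof.
rewrite pinM /pin_mul pin_form_a leqnn /=; congr PinElt; last by rewrite !GRing.add0r.
by apply/ffunP=> j; rewrite !ffunE Z2_addxx.
Qed.

Lemma Pin_zz : pin_z * pin_z = 1.
Proof.
rewrite pinM pin1 /pin_mul /= pin_form0l Z2_addxx GRing.addr0; congr PinElt.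
exact: GRing.addr0.
Qed.

Lemma Pin_zM x : pin_z * x = PinElt (pin_vec x) (pin_sgn x + 1)%R.
Proof.
by rewrite pinM /pin_mul /= pin_form0l GRing.addr0 GRing.add0r [(1 + _)%R]GRing.addrC.
Qed.

Lemma Pin_za i : pin_z * pin_a i = pin_a i * pin_z.
Proof.
rewrite Pin_zM pinM /pin_mul /= [pin_form _ 0%R]pin_form_sum_supp ?GRing.addr0 //.
by move=> k j _; rewrite !ffunE GRing.mulr0.
Qed.

Lemma Pin_comm i j : i != j -> pin_a i * pin_a j = pin_z * (pin_a j * pin_a i).
Proof.
move=> ij; rewrite Pin_zM !pinM /pin_mul !pin_form_a /= !GRing.add0r.
congr PinElt; first exact: GRing.addrC.
by case: (ltngtP i j) => [ij'|ij'|/val_inj /eqP]; rewrite ?(negPf ij) ?GRing.add0r ?Z2_addxx.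
Qed.

Lemma sorted_index_enum : sorted (fun i j : 'I_n => (i < j)%N) (index_enum 'I_n).
Proof.
have : sorted ltn (map val (enum 'I_n)) by rewrite val_enum_ord iota_ltn_sorted.
by rewrite sorted_map enumT [index_enum _]unlock.
Qed.

Section Lift.
Variables (H : groupType) (b : 'I_n -> H) (w : H).

Definition pin_lift x : H :=
  w ^+ pin_sgn x * \prod_(i < n) b i ^+ pin_vec x i.

Hypotheses (bb : forall i, b i * b i = w) (ww : w * w = 1)
  (wb : forall i, w * b i = b i * w)
  (bC : forall i j, i != j -> b i * b j = w * (b j * b i)).

Lemma expZ2 (h k : H) (c d : 'Z_2) : h * h = k ->
  h ^+ c * h ^+ d = k ^+ (c * d)%R * h ^+ (c + d)%R.
Proof.
move=> hk; case: c => [[|[|//]] ?]; case: d => [[|[|//]] ?] /=;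
  by rewrite ?expg0 ?expg1 ?mul1g ?mulg1 //.
Qed.

Lemma lift_wD (c d : 'Z_2) : w ^+ (c + d)%R = w ^+ c * w ^+ d.
Proof. by rewrite (expZ2 _ _ ww) expg1n mul1g. Qed.

Lemma lift_wC (c : 'Z_2) r u :
  w ^+ c * \prod_(i <- r) b i ^+ u i = (\prod_(i <- r) b i ^+ u i) * w ^+ c.
Proof.
elim: r => [|i r IH]; first by rewrite big_nil mul1g mulg1.
rewrite big_cons mulgA (_ : w ^+ c * b i ^+ u i = b i ^+ u i * w ^+ c).
  by rewrite -!mulgA IH.
by apply: commuteX2; exact: wb.
Qed.

Lemma lift_bC i r u (d : 'Z_2) : i \notin r ->
  (\prod_(j <- r) b j ^+ u j) * b i ^+ d =
  w ^+ (d * \sum_(j <- r) u j)%R * (b i ^+ d * \prod_(j <- r) b j ^+ u j).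
Proof.
elim: r => [|j r IH]; first by rewrite !big_nil mul1g mulg1 GRing.mulr0 expg0 mul1g.
rewrite inE negb_or => /andP[ij ir]; rewrite !big_cons -mulgA (IH ir).
have wb' (e c : 'Z_2) k : b k ^+ c * w ^+ e = w ^+ e * b k ^+ c.
  by apply/esym; apply: commuteX2; exact: wb.
rewrite !mulgA wb' GRing.mulrDr lift_wD [w ^+ _ * w ^+ _](_ : _ =
   w ^+ (d * \sum_(j0 <- r) u j0)%R * w ^+ (d * u j)%R); last first.
  by rewrite -!lift_wD GRing.addrC.
rewrite -!mulgA; congr (_ * _); rewrite !mulgA; congr (_ * _).
case: d {IH} => [[|[|//]] di] /=; case: (u j) => [[|[|//]] ui] /=;
  rewrite ?expg0 ?expg1 ?mul1g ?mulg1 //.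
by rewrite (bC (i := j)) 1?eq_sym // mulgA.
Qed.

Lemma lift_prod (r : seq 'I_n) u v :
  sorted (fun i j : 'I_n => (i < j)%N) r ->
  (\prod_(i <- r) b i ^+ u i) * (\prod_(i <- r) b i ^+ v i) =
  w ^+ (\sum_(i <- r) \sum_(j <- r | (j <= i)%N) u i * v j)%R *
    \prod_(i <- r) b i ^+ (u i + v i)%R.
Proof.
have tr : transitive (fun i j : 'I_n => (i < j)%N).
  by move=> ? ? ?; exact: ltn_trans.
elim: r => [|i r IH] srt; first by rewrite !big_nil expg0 !mul1g.
have /allP ir := order_path_min tr srt.
have inr : i \notin r by apply/negP=> /ir; rewrite ltnn.
rewrite !big_cons leqnn.
have -> : (\sum_(j <- r | (j <= i)%N) u i * v j = 0)%R.
  rewrite big_seq_cond big1 // => j /andP[/ir]; by rewrite ltnNge => /negPf ->.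
rewrite GRing.addr0.
have -> : (\sum_(k <- r) \sum_(j <- i :: r | (j <= k)%N) u k * v j =
   v i * \sum_(k <- r) u k + \sum_(k <- r) \sum_(j <- r | (j <= k)%N) u k * v j)%R.
  rewrite GRing.mulr_sumr -big_split /=; apply: eq_big_seq => k /ir /ltnW ik.
  by rewrite big_cons ik GRing.mulrC.
have wb' (e c : 'Z_2) k (h : H) : b k ^+ c * (w ^+ e * h) = w ^+ e * (b k ^+ c * h).
  by rewrite !mulgA; congr (_ * h); apply/esym; apply: commuteX2; exact: wb.
rewrite -mulgA [X in _ * X]mulgA (lift_bC _ _ inr) -!mulgA (IH (path_sorted srt)).
rewrite !wb' [b i ^+ u i * _]mulgA (expZ2 _ _ (bb i)) !mulgA -!lift_wD.
by congr (w ^+ _ * _ * _); rewrite GRing.addrC; reflexivity.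
Qed.

Lemma pin_lift_morph : {morph pin_lift : x y / x * y}.
Proof.
case=> u c [v d]; rewrite /pin_lift pinM /pin_mul !lift_wD -!mulgA; congr (_ * _).
rewrite [RHS]mulgA -lift_wC -!mulgA; congr (_ * _).
rewrite lift_prod; last exact: sorted_index_enum.
by congr (_ * _); apply: eq_bigr => i _; rewrite ffunE.
Qed.

Lemma pin_lift_a i : pin_lift (pin_a i) = b i.
Proof.
rewrite /pin_lift expg0 mul1g -[RHS](big_pred1_eq *%g) big_mkcond.
by apply: eq_bigr => j _; rewrite ffunE; case: eqP.
Qed.

Lemma pin_lift_z : pin_lift pin_z = w.
Proof.
by rewrite /pin_lift expg1 big1 ?mulg1 // => i _; rewrite ffunE.
Qed.

End Lift.

Lemma pin_lift_id x : pin_lift pin_a pin_z x = x.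
Proof.
have zX (c : 'Z_2) : pin_z ^+ c = PinElt 0%R c.
  case: c => [[|[|//]] cP]; rewrite ?expg0 ?expg1; congr PinElt; exact/val_inj.
have prodE (r : seq 'I_n) u : sorted (fun i j : 'I_n => (i < j)%N) r ->
    \prod_(i <- r) pin_a i ^+ u i = PinElt [ffun j => if j \in r then u j else 0%R] 0%R.
  elim: r => [|i r IH] srt.
    by rewrite big_nil; congr PinElt; apply/ffunP=> j; rewrite !ffunE.
  have tr : transitive (fun i j : 'I_n => (i < j)%N).
    by move=> ? ? ?; exact: ltn_trans.
  have /allP ir := order_path_min tr srt.
  have inr : i \notin r by apply/negP=> /ir; rewrite ltnn.
  rewrite big_cons (IH (path_sorted srt)).
  have -> : pin_a i ^+ u i = PinElt [ffun j => if j == i then u i else 0%R] 0%R.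
    case: (u i) => [[|[|//]] cP]; rewrite ?expg0 ?expg1; congr PinElt;
      apply/ffunP=> j; rewrite !ffunE; case: eqP => // _; exact/val_inj.
  rewrite pinM /pin_mul /= !GRing.add0r pin_form_sum_supp; last first.
    move=> k j jk; rewrite !ffunE; case: eqP => [ki|]; last by rewrite GRing.mul0r.
    case: ifP => [/ir|]; last by rewrite GRing.mulr0.
    by rewrite -ki ltnNge jk.
  congr PinElt; apply/ffunP=> j; rewrite !ffunE inE.
  by case: eqP => [->|_]; rewrite ?(negPf inr) ?GRing.addr0 ?GRing.add0r.
case: x => u c; rewrite /pin_lift zX prodE; last exact: sorted_index_enum.
rewrite pinM /pin_mul /= pin_form0l !GRing.addr0 GRing.add0r; congr PinElt.
by apply/ffunP=> j; rewrite ffunE mem_index_enum.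
Qed.

Lemma Pin_lift_uniq (H : groupType) (f : Pin n -> H) : {morph f : x y / x * y} ->
  f =1 pin_lift (f \o pin_a) (f pin_z).
Proof.
move=> fM x; have f1 : f 1 = 1 by apply: (mulIg (f 1)); rewrite -fM !mul1g.
have fX y k : f (y ^+ k) = f y ^+ k by elim: k => // k IH; rewrite !expgS fM IH.
rewrite -[in LHS](pin_lift_id x) /pin_lift fM fX (big_morph f fM f1).
by congr (_ * _); apply: eq_bigr => i _; rewrite fX.
Qed.

Definition pin_act (s : 'S_n) : Pin n -> Pin n := pin_lift (fun i => pin_a (s i)) pin_z.

Lemma pin_actM s : {morph pin_act s : x y / x * y}.
Proof.
apply: pin_lift_morph => [i||i|i j ij]; rewrite ?Pin_aa ?Pin_zz ?Pin_za //.
by apply: Pin_comm; rewrite (inj_eq perm_inj).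
Qed.

Lemma pin_act_a s i : pin_act s (pin_a i) = pin_a (s i).
Proof. exact: pin_lift_a. Qed.

Lemma pin_act_z s : pin_act s pin_z = pin_z.
Proof. exact: pin_lift_z. Qed.

Lemma pin_act1 x : pin_act 1 x = x.
Proof.
rewrite -[RHS]pin_lift_id /pin_act /pin_lift.
by congr (_ * _); apply: eq_bigr => i _; rewrite perm1.
Qed.

Lemma pin_act_comp s t x : pin_act (t * s) x = pin_act s (pin_act t x).
Proof.
rewrite [RHS](Pin_lift_uniq (f := pin_act s \o pin_act t)); last first.
  by move=> y1 y2 /=; rewrite !pin_actM.
rewrite /pin_lift /= !pin_act_z.
by congr (_ * _); apply: eq_bigr => i _; rewrite /= !pin_act_a permM.
Qed.

End Pin.

(* A left action of S_n on K by automorphisms.  The perm product t * s of the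
   library is "t first, then s", i.e. the composite usually written st. *)
Record Sn_action (n : nat) (K : finGroupType) := SnAction {
  sn_act :> 'S_n -> K -> K;
  sn_actM : forall s, {morph sn_act s : x y / x * y};
  sn_act1 : forall x, sn_act 1 x = x;
  sn_act_comp : forall s t x, sn_act (t * s) x = sn_act s (sn_act t x) }.

(* K ><| S_n with the product (k, s)(h, t) = (k s(h), st). *)
Record semidirect (n : nat) (K : finGroupType) (A : Sn_action n K) :=
  Semidirect { sd_ker : K; sd_perm : 'S_n }.

Section Semidirect.
Variables (n : nat) (K : finGroupType) (A : Sn_action n K).
Local Notation T := (semidirect A).
Implicit Types x y : T.

Definition sd_to x := (sd_ker x, sd_perm x).
Definition sd_of p : T := Semidirect A p.1 p.2.
Lemma sd_toK : cancel sd_to sd_of. Proof. by case. Qed.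

HB.instance Definition _ := Finite.copy T (can_type sd_toK).

Definition sd_mul x y : T :=
  Semidirect A (sd_ker x * A (sd_perm x) (sd_ker y)) (sd_perm y * sd_perm x).
Definition sd_one : T := Semidirect A 1 1.
Definition sd_inv x : T :=
  Semidirect A (A (sd_perm x)^-1 (sd_ker x)^-1) (sd_perm x)^-1.

Lemma sd_mulA : associative sd_mul.
Proof.
case=> [k s] [h t] [l r]; rewrite /sd_mul /= sn_actM sn_act_comp.
by congr Semidirect; rewrite mulgA.
Qed.

Lemma sd_mul1 : left_id sd_one sd_mul.
Proof. by case=> k s; rewrite /sd_mul /= sn_act1 mul1g mulg1. Qed.

Lemma sd_mulV : left_inverse sd_one sd_inv sd_mul.
Proof.
case=> k s; rewrite /sd_mul /= -sn_actM mulVg mulgV; congr Semidirect.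
by apply: (mulIg (A s^-1 1)); rewrite -sn_actM !mul1g.
Qed.

HB.instance Definition _ := Finite_isGroup.Build T sd_mulA sd_mul1 sd_mulV.

Lemma sdM x y : x * y = sd_mul x y. Proof. by []. Qed.
End Semidirect.

HB.instance Definition _ (I : finType) (G : finGroupType) := Group.on {ffun I -> G}.

Section PermAction.
Variables (n : nat) (G : finGroupType).

Definition ffun_act (s : 'S_n) (g : {ffun 'I_n -> G}) : {ffun 'I_n -> G} :=
  [ffun i => g (s^-1 i)].

Lemma ffun_actM s : {morph ffun_act s : x y / x * y}.
Proof. by move=> x y; apply/ffunP=> i; rewrite !ffunE. Qed.

Lemma ffun_act1 x : ffun_act 1 x = x.
Proof. by apply/ffunP=> i; rewrite ffunE invg1 perm1. Qed.

Lemma ffun_act_comp s t x : ffun_act (t * s) x = ffun_act s (ffun_act t x).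
Proof. by apply/ffunP=> i; rewrite !ffunE invMg permM. Qed.

Definition ffun_action : Sn_action n {ffun 'I_n -> G} :=
  SnAction ffun_actM ffun_act1 ffun_act_comp.
End PermAction.

Section HGamma.
Variables (G : finGroupType) (n : nat).

Definition tilde_act (s : 'S_n) (k : {ffun 'I_n -> G} * Pin n) :=
  (ffun_act s k.1, pin_act s k.2).

Lemma tilde_actM s : {morph tilde_act s : x y / x * y}.
Proof.
by move=> x y; rewrite /tilde_act [(x * y).1]/= [(x * y).2]/= ffun_actM pin_actM.
Qed.

Lemma tilde_act1 x : tilde_act 1 x = x.
Proof. by case: x => g a; rewrite /tilde_act /= ffun_act1 pin_act1. Qed.

Lemma tilde_act_comp s t x : tilde_act (t * s) x = tilde_act s (tilde_act t x).
Proof. by rewrite /tilde_act /= ffun_act_comp pin_act_comp. Qed.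

Definition tilde_action := SnAction tilde_actM tilde_act1 tilde_act_comp.

(* HGt is (Gamma^n x Pi_n) ><| S_n and HG is (Gamma x Z_2)^n ><| S_n; theta is
   onto with kernel {1, z} by theta_surj and ker_theta. *)
Definition HGt := semidirect tilde_action.
Definition HG := semidirect (ffun_action n (G * 'Z_2)%type).

HB.instance Definition _ := FinGroup.on HGt.
HB.instance Definition _ := FinGroup.on HG.

Definition HGt_z : HGt := Semidirect tilde_action (1, pin_z n) 1.

Definition theta (x : HGt) : HG :=
  Semidirect (ffun_action n (G * 'Z_2)%type)
    [ffun i => ((sd_ker x).1 i, pin_vec (sd_ker x).2 i)] (sd_perm x).

Lemma pin_vecM (x y : Pin n) : pin_vec (x * y) = (pin_vec x + pin_vec y)%R.
Proof. by []. Qed.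

Lemma pin_vec_act (s : 'S_n) (x : Pin n) i : pin_vec (pin_act s x) i = pin_vec x (s^-1 i).
Proof.
have vX (y : Pin n) (c : 'Z_2) j : pin_vec (y ^+ c) j = (c * pin_vec y j)%R.
  by case: c => [[|[|//]] cP]; rewrite ?expg0 ?expg1 ?ffunE;
    [rewrite (_ : Ordinal cP = 0%R) ?GRing.mul0r | rewrite (_ : Ordinal cP = 1%R) ?GRing.mul1r];
    rewrite //; exact/val_inj.
rewrite /pin_act /pin_lift pin_vecM ffunE vX ffunE GRing.mulr0 GRing.add0r.
rewrite (big_morph (fun y : Pin n => pin_vec y i) (id1 := 0%R) (op1 := +%R%R)); last 2 first.
- by move=> y z; rewrite pin_vecM ffunE.
- by rewrite ffunE.
rewrite (bigD1 (s^-1 i)) //= vX ffunE permKV eqxx GRing.mulr1 big1 ?GRing.addr0 // => j ji.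
by rewrite vX ffunE; case: eqP => [ij|]; [rewrite ij permK eqxx in ji | rewrite GRing.mulr0].
Qed.

Lemma theta_morphM : {in [set: HGt] &, {morph theta : x y / x * y}}.
Proof.
case=> [[g a] s] [[h b] t] _ _; rewrite !sdM /theta /sd_mul /=; congr Semidirect.
apply/ffunP=> i; have := pin_vec_act s b i; rewrite !ffunE => E; rewrite -E; reflexivity.
Qed.

Canonical theta_morphism := Morphism theta_morphM.

Lemma ker_theta : 'ker theta = [set 1; HGt_z].
Proof.
apply/setP=> x; rewrite !inE /=; apply/idP/idP.
- case: x => [[g [u c]] s] /eqP [E ->].
  have gE i : g i = 1 /\ u i = 0%R.
    by move/ffunP: E => /(_ i); rewrite !ffunE /= => -[-> ->].
  have -> : g = 1 by apply/ffunP=> i; rewrite ffunE (gE i).1.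
  have -> : u = 0%R by apply/ffunP=> i; rewrite ffunE (gE i).2.
  case: c => [[|[|//]] cP]; apply/orP; [left|right]; apply/eqP;
    congr Semidirect; congr pair; congr PinElt; exact/val_inj.
- case/orP=> /eqP ->; apply/eqP; congr Semidirect; by apply/ffunP=> i; rewrite !ffunE.
Qed.

Lemma theta_surj : theta @* [set: HGt] = [set: HG].
Proof.
apply/setP=> -[k s]; rewrite [RHS]inE; apply/imsetP.
exists (Semidirect tilde_action ([ffun i => (k i).1], PinElt [ffun i => (k i).2] 0%R) s).
  by rewrite !inE.
by congr Semidirect; apply/ffunP=> i; rewrite !ffunE /=; case: (k i).
Qed.

Definition parity (x : HG) : 'Z_2 := (\sum_(i < n) (sd_ker x i).2)%R.

Lemma parityM : {morph parity : x y / x * y >-> (x + y)%R}.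
Proof.
case=> [k s] [h t]; rewrite sdM /parity /= -/(parity _).
rewrite [X in (_ + X)%R](reindex_perm s^-1) -big_split /=.
by apply: eq_bigr => i _; rewrite !ffunE.
Qed.

Definition even_class (C : {set HG}) : bool := [forall x in C, parity x == 0%R].
Definition odd_class (C : {set HG}) : bool := [forall x in C, parity x == 1%R].

Definition class_splits (C : {set HG}) : Prop :=
  exists D1 D2 : {set HGt},
    [/\ D1 \in classes [set: HGt], D2 \in classes [set: HGt], D1 != D2
      & theta @^-1: C = D1 :|: D2].

End HGamma.

Record intpart := IntPart {
  part_seq :> seq nat;
  part_seqP : sorted geq part_seq && (0%N \notin part_seq) }.

HB.instance Definition _ := [isSub for part_seq].
HB.instance Definition _ := [Countable of intpart by <:].

Definition empty_part : intpart := @IntPart [::] isT.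

Definition mult_seq (N : nat) (m : nat -> nat) : seq nat :=
  flatten [seq nseq (m i) i | i <- rev (iota 1 N)].

Lemma mult_seqP N m : sorted geq (mult_seq N m) && (0%N \notin mult_seq N m).
Proof.
have mem_le k : {in mult_seq k m, forall i, 0 < i <= k}%N.
  move=> i /flattenP[s /mapP[j]].
  by rewrite mem_rev mem_iota add1n ltnS => jk -> /nseqP[-> _].
apply/andP; split; last by apply/negP=> /mem_le.
have gt : transitive geq by move=> a b c ba ac; exact: leq_trans ac ba.
rewrite sorted_pairwise //.
elim: N => [//|N IH].
have -> : mult_seq N.+1 m = nseq (m N.+1) N.+1 ++ mult_seq N m.
  by rewrite /mult_seq -(addn1 N) iotaD rev_cat map_cat flatten_cat /= cats0 add1n addn1.
rewrite pairwise_cat IH andbT; apply/andP; split.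
  by apply/allrelP=> i j /nseqP[-> _] /mem_le /andP[_ jN]; exact: leqW.
by rewrite -sorted_pairwise //; elim: (m N.+1) => [|[|k] IHk] //=; rewrite leqnn.
Qed.

(* The partition (i^(m i))_(i >= 1), for m i = 0 when i > N. *)
Definition mult_part N m : intpart := IntPart (mult_seqP N m).

Lemma count_mult_part N m i : (0 < i <= N)%N -> count_mem i (mult_part N m) = m i.
Proof.
elim: N => [|N IH]; first by case: i.
have E : part_seq (mult_part N.+1 m) = nseq (m N.+1) N.+1 ++ mult_part N m.
  by rewrite /= /mult_seq -(addn1 N) iotaD rev_cat map_cat flatten_cat /= cats0 add1n addn1.
rewrite E count_cat count_nseq /= => /andP[i0]; rewrite leq_eqVlt => /orP[/eqP ->|].
  rewrite eqxx mul1n (count_memPn _) ?addn0 //.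
  apply/negP=> /flattenP[s /mapP[j]].
  by rewrite mem_rev mem_iota add1n ltnS => /andP[_ jN] -> /nseqP[jE _]; rewrite -jE ltnn in jN.
by rewrite ltnS => iN; rewrite IH ?i0 // gtn_eqF ?mul0n.
Qed.

Section PartitionValued.
Variable X : finType.
Local Notation ppart := {ffun X -> intpart}.

Definition pp_norm (rho : ppart) : nat := \sum_(c : X) sumn (rho c).
Definition pp_length (rho : ppart) : nat := \sum_(c : X) size (rho c).
Definition pp_empty : ppart := [ffun => empty_part].

Definition OP (n : nat) (rho : ppart) : bool :=
  (pp_norm rho == n) && [forall c : X, all odd (rho c)].
Definition SP (n : nat) (rho : ppart) : bool :=
  (pp_norm rho == n) && [forall c : X, uniq (rho c)].
Definition SPminus (n : nat) (rho : ppart) : bool := SP n rho && odd (pp_length rho).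
End PartitionValued.

Definition conj_classes (G : finGroupType) := {c : {set G} | c \in classes [set: G]}.
HB.instance Definition _ (G : finGroupType) := Finite.on (conj_classes G).

Section Types.
Variables (G : finGroupType) (n : nat).
Implicit Types (x : HG G n) (O : {set 'I_n}) (c : {set G}) (e : 'Z_2).

(* g_(j_m) ... g_(j_1), for the cycle (j_1 ... j_m) of the permutation of x
   written from the starting point j_1 = j. *)
Definition cycle_prod x (j : 'I_n) : G :=
  \prod_(i <- rev (traject (sd_perm x) j #|porbit (sd_perm x) j|)) (sd_ker x i).1.

(* Another starting point conjugates the cycle-product. *)
Lemma cycle_prod_perm x j :
  cycle_prod x (sd_perm x j) = cycle_prod x j ^ (sd_ker x j).1^-1.
Proof.
rewrite /cycle_prod; set s := sd_perm x; set g := fun i => (sd_ker x i).1.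
have -> : porbit s (s j) = porbit s j.
  by apply/eqP; rewrite eq_porbit_mem -{1}(expg1 s) mem_porbit.
have : (0 < #|porbit s j|)%N by apply/card_gt0P; exists j; exact: porbit_id.
have := iter_porbit s j; case: #|_| => // m jE _.
rewrite trajectSr -iterSr jE rev_rcons big_cons trajectS rev_cons.
by rewrite -cats1 big_cat big_seq1 /= /conjg invgK mulgK.
Qed.

(* The sign of a cycle with support O: 0 stands for +, 1 for -. *)
Definition cycle_sgn x O : 'Z_2 := (\sum_(i in O) (sd_ker x i).2)%R.

Definition cycle_mult x e c (i : nat) : nat :=
  #|[set O in porbits (sd_perm x) | [&& #|O| == i, cycle_sgn x O == e
      & [exists j in O, cycle_prod x j \in c]]]|.

Definition htype_sgn x e : {ffun conj_classes G -> intpart} :=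
  [ffun c => mult_part n (cycle_mult x e (val c))].

Definition htype x := (htype_sgn x 0%R, htype_sgn x 1%R).

Definition type_class (rp rm : {ffun conj_classes G -> intpart}) : {set HG G n} :=
  [set x | htype x == (rp, rm)].
End Types.

(* Main.v *)
Require Import Defs.
From mathcomp Require Import all_boot all_order all_algebra all_fingroup.
From mathcomp Require Import ring.

(* Lift x to (g, a s) in the double cover, let p be its parity, and let C(x) be
   the centralizer of its image in HG.  The class of x splits iff the character
   y |-> [y, x] in {1, z} of C(x) is trivial.  For a cycle O of s of length m and
   sign e, the product of the a_j along O has commutator
   z^(m (p + 1) + 1 + e) with x, and the restriction of x to O has commutator
   z^(e (p + 1)).  Two odd cycles with the same label are exchanged by an element
   whose commutator with x is z.  These produce z in every case not listed.
   Conversely, if all cycles are even of odd length, x is conjugate to (g, s)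
   with s of odd order, and b = z s(b) is impossible in Pi_n; if all cycles are
   odd with distinct labels, C(x) fixes every cycle, so that modulo Gamma^n it is
   generated by the above elements, which then commute with x.

   Conjugacy in HG is decided by types (extend_transport, conj_htype), and every
   type has a normal form in which all the weight of a cycle sits on its base
   point. *)

Set Implicit Arguments.
Unset Strict Implicit.
Unset Printing Implicit Defensive.

Import GRing.Theory.
Local Open Scope group_scope.

(** * Commutation and permutation of generators in [Pin n] *)

Section PinTheory.
Variable n : nat.
Implicit Types (u v : {ffun 'I_n -> 'Z_2}) (a b x y : Pin n) (r : seq 'I_n).

(* z ^ c *)
Definition pin_c (c : 'Z_2) : Pin n := PinElt 0%R c.

Lemma pin_cM c x : pin_c c * x = PinElt (pin_vec x) (pin_sgn x + c)%R.
Proof. by rewrite pinM /pin_mul /= pin_form0l addr0 add0r addrC. Qed.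

Lemma pin_mulc c x : x * pin_c c = PinElt (pin_vec x) (pin_sgn x + c)%R.
Proof.
rewrite pinM /pin_mul /= pin_form_sum_supp ?addr0 // => i j _.
by rewrite !ffunE mulr0.
Qed.

Lemma pin_cC c x : pin_c c * x = x * pin_c c.
Proof. by rewrite pin_cM pin_mulc. Qed.

Lemma pin_cD c d : pin_c (c + d)%R = pin_c c * pin_c d.
Proof. by rewrite pin_cM /pin_c addrC. Qed.

Lemma pin_c_inj : injective pin_c. Proof. by move=> c d []. Qed.

Lemma pin_vec_inj x y : pin_vec x = pin_vec y ->
  x = pin_c (pin_sgn x + pin_sgn y)%R * y.
Proof.
by case: x y => [u c] [v d] /= ->; rewrite pin_cM /= addrCA Z2_addxx addr0.
Qed.

Definition wt u : 'Z_2 := (\sum_i u i)%R.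
Definition dot u v : 'Z_2 := (\sum_i u i * v i)%R.

(** The two triangular sums together cover each pair of distinct indices once, as in [wt u * wt v].
    The diagonal is covered twice, which leaves the extra term [dot u v]. *)
Lemma pin_form_sym u v : (pin_form u v + pin_form v u = wt u * wt v + dot u v)%R.
Proof.
rewrite /pin_form /wt /dot mulr_suml.
under [X in (_ = X + _)%R]eq_bigr do rewrite mulr_sumr.
rewrite [X in (_ + X)%R](exchange_big_dep xpredT) //= -!big_split.
apply: eq_bigr => i _ /=.
rewrite [X in (X + _)%R]big_mkcond [X in (_ + X)%R]big_mkcond -big_split /=.
rewrite [LHS](bigD1 i) //= [in RHS](bigD1 i) //= leqnn [(v i * _)%R]mulrC.
rewrite addrAC; congr (_ + _ + _)%R.
apply: eq_bigr => j ji; rewrite [(v j * _)%R]mulrC.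
case: ltngtP => [||/val_inj E]; rewrite ?addr0 ?add0r //.
by rewrite E eqxx in ji.
Qed.

(** Each pair of distinct generators, one from [x] and one from [y], contributes a factor z when
    exchanged, while equal generators commute. The number of such pairs is [wt * wt] minus the
    number of common generators. *)
Lemma pin_commE x y :
  x * y = pin_c (wt (pin_vec x) * wt (pin_vec y) + dot (pin_vec x) (pin_vec y))%R
          * (y * x).
Proof.
rewrite pin_cM !pinM /pin_mul /= -pin_form_sym [(pin_vec y + _)%R]addrC; congr PinElt.
have -> (p q c d : 'Z_2) : (d + c + q + (p + q) = c + d + p + (q + q))%R by ring.
by rewrite Z2_addxx addr0.
Qed.

Lemma pin_vec1 : pin_vec (1 : Pin n) = 0%R. Proof. by []. Qed.

Lemma pin_act_c s c : pin_act s (pin_c c) = pin_c c.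
Proof.
case: c => [[|[|//]] cP].
  rewrite (_ : pin_c _ = 1); last by congr PinElt; exact/val_inj.
  by apply: (mulIg (pin_act s 1)); rewrite -pin_actM !mul1g.
rewrite (_ : pin_c _ = pin_z n) ?pin_act_z //; congr PinElt; exact/val_inj.
Qed.

Lemma pin_act_eq (s t : {perm 'I_n}) a : (forall i, pin_vec a i != 0%R -> s i = t i) ->
  pin_act s a = pin_act t a.
Proof.
move=> E; rewrite /pin_act /pin_lift; congr (_ * _); apply: eq_bigr => i _.
have [->|/E -> //] := eqVneq (pin_vec a i) 0%R.
by rewrite !expg0.
Qed.

(** The factors keep the order of [r], so a permutation acts through [map] and no reordering sign
    appears. *)
Definition pin_seq r : Pin n := \prod_(i <- r) pin_a i.

Lemma pin_seq_act s r : pin_act s (pin_seq r) = pin_seq (map s r).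
Proof.
rewrite /pin_seq big_map (big_morph (pin_act s) (@pin_actM n s) (pin_act_c s 0%R)).
by apply: eq_bigr => i _; rewrite pin_act_a.
Qed.

Lemma pin_seq_vec r i : uniq r -> pin_vec (pin_seq r) i = (i \in r)%:R%R.
Proof.
elim: r => [|j r IH]; first by rewrite /pin_seq big_nil pin_vec1 ffunE.
move=> /= /andP[jr /IH E]; rewrite /pin_seq big_cons pin_vecM ffunE -/(pin_seq r) E.
rewrite ffunE inE; case: eqP => [->|_]; last by rewrite add0r.
by rewrite (negPf jr) addr0.
Qed.

Lemma wt_pin_seq r : uniq r -> wt (pin_vec (pin_seq r)) = (size r)%:R%R.
Proof.
move=> ur; rewrite /wt; under eq_bigr do rewrite pin_seq_vec //.
by rewrite -natr_sum -(card_uniqP ur) -sum1_card [in RHS]big_mkcond /=;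
   congr (_%:R)%R; apply: eq_bigr => i _; case: (i \in r).
Qed.

Lemma dot_pin_seq u r : uniq r -> dot u (pin_vec (pin_seq r)) = (\sum_(i in r) u i)%R.
Proof.
move=> ur; rewrite /dot [RHS]big_mkcond; apply: eq_bigr => i _.
by rewrite pin_seq_vec //; case: (i \in r); rewrite ?mulr1 ?mulr0.
Qed.

(** The generator [a_j] passes [size r] generators, all different from it, and each passage costs a
    factor z. *)
Lemma pin_seq_rot j r : uniq (j :: r) ->
  pin_seq (rcons r j) = pin_c (size r)%:R%R * pin_seq (j :: r).
Proof.
move=> /= /andP[jr ur]; rewrite /pin_seq -cats1 big_cat big_seq1 big_cons /= -/(pin_seq r).
rewrite [LHS]pin_commE wt_pin_seq //; congr (pin_c _ * _).
have -> : pin_a j = pin_seq [:: j] by rewrite /pin_seq big_seq1.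
rewrite wt_pin_seq // dot_pin_seq //= mulr1 big1 ?addr0 // => i.
by rewrite inE => /eqP ->; rewrite pin_seq_vec // (negPf jr).
Qed.
End PinTheory.

(** * Commutators in the double cover with [cycle_a] and [cycle_part] *)

Section Commutators.
Variables (G : finGroupType) (n : nat).
Implicit Types (x y : HGt G n) (g h : {ffun 'I_n -> G}) (a b : Pin n) (s t : 'S_n).

Definition hgt g a s : HGt G n := Semidirect (tilde_action G n) (g, a) s.
Definition HGt_c c : HGt G n := hgt 1 (pin_c n c) 1.

Lemma hgtM g a s h b t :
  hgt g a s * hgt h b t = hgt (g * ffun_act s h) (a * pin_act s b) (t * s).
Proof. by []. Qed.

Lemma HGt_cM c g a s : HGt_c c * hgt g a s = hgt g (pin_c n c * a) s.
Proof. by rewrite hgtM ffun_act1 pin_act1 mulg1 mul1g. Qed.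

Lemma HGt_cC c x : HGt_c c * x = x * HGt_c c.
Proof.
case: x => [[g a] s]; rewrite -/(hgt g a s) HGt_cM hgtM pin_act_c pin_cC mul1g.
by rewrite (_ : ffun_act s 1 = 1) ?mulg1 //; apply/ffunP=> i; rewrite !ffunE.
Qed.

Lemma HGt_c0 : HGt_c 0%R = 1. Proof. by []. Qed.
(** The two products are compared coordinate by coordinate; the power of z shows only in the
    coordinate in [Pin n]. *)
Lemma HGt_commP c g a s h b t :
  reflect [/\ s * t = t * s, h * ffun_act t g = g * ffun_act s h &
           b * pin_act t a = pin_c n c * (a * pin_act s b)]
    (hgt h b t * hgt g a s == HGt_c c * (hgt g a s * hgt h b t)).
Proof.
rewrite [X in X == _]hgtM [X in HGt_c c * X]hgtM HGt_cM.
apply: (iffP eqP) => [E|[-> -> ->]//].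
split; first exact: (congr1 (fun x : HGt G n => sd_perm x) E).
  exact: (congr1 (fun x : HGt G n => (sd_ker x).1) E).
exact: (congr1 (fun x : HGt G n => (sd_ker x).2) E).
Qed.

Definition cycle_a s j : HGt G n := hgt 1 (pin_seq (traject s j #|porbit s j|)) 1.

Lemma ffun_act_1r s : ffun_act s (1 : {ffun 'I_n -> G}) = 1.
Proof. by apply/ffunP=> i; rewrite !ffunE. Qed.

(** Applying [s] rotates the list of the cycle by one place. This moves one generator past m - 1
    others, and m - 1 = m + 1 modulo 2. *)
Lemma pin_act_pin_seq_cycle s j (r := traject s j #|porbit s j|) :
  pin_act s (pin_seq r) = pin_c n (#|porbit s j|%:R + 1)%R * pin_seq r.
Proof.
have map_s m i : map s (traject s i m) = traject s (s i) m.
  by elim: m i => //= m IH i; rewrite IH.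
have := uniq_traject_porbit s j; have := iter_porbit s j.
rewrite /r pin_seq_act map_s; case: #|porbit s j| (card_porbit_neq0 s j) => // m _.
rewrite [traject s (s j) _]trajectSr -iterSr => -> ur; rewrite pin_seq_rot // size_traject.
by rewrite [m.+1%:R%R]mulrS addrAC Z2_addxx add0r.
Qed.

(** Two effects add up: exchanging [a] with the product of the generators of the cycle gives m p
    plus the sign of the cycle, and letting [s] act on that product gives m + 1. *)
Lemma cycle_a_comm g a s j (x := hgt g a s) (p := wt (pin_vec a)) (m := #|porbit s j|) :
  cycle_a s j * x = HGt_c (m%:R * (p + 1) + 1 + \sum_(i in porbit s j) pin_vec a i)%R
                    * (x * cycle_a s j).
Proof.
apply/eqP/HGt_commP; split; rewrite ?mul1g ?mulg1 ?ffun_act1 ?ffun_act_1r ?mulg1 //.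
rewrite pin_act1 pin_act_pin_seq_cycle -/m [a * _]mulgA -[a * _]pin_cC -mulgA.
rewrite [RHS]mulgA -pin_cD [LHS]pin_commE.
have ur := uniq_traject_porbit s j.
rewrite [in X in pin_c _ X](_ : dot _ _ =
    dot (pin_vec a) (pin_vec (pin_seq (traject s j m)))).
  rewrite wt_pin_seq // dot_pin_seq // size_traject -/m -/p.
  rewrite -(eq_bigl _ _ (porbit_traject s j)).
  congr (pin_c _ _ * _); set q := (\sum_(i in _) _)%R.
  have -> : (m%:R * (p + 1) + 1 + q + (m%:R + 1) =
             m%:R * p + q + ((m%:R + 1) + (m%:R + 1)))%R
    by ring.
  by rewrite Z2_addxx addr0.
by apply: eq_bigr => i _; rewrite mulrC.
Qed.

Definition cycle_part g a s (B : {set 'I_n}) : HGt G n :=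
  hgt [ffun i => if i \in B then g i else 1]
      (PinElt [ffun i => if i \in B then pin_vec a i else 0%R] 0%R) (restr_perm B s).

Lemma restr_permN s (B : {set 'I_n}) : (forall i, (s i \in B) = (i \in B)) ->
  s \in 'N(B | 'P).
Proof. by move=> sB; apply/astabsP=> i; exact: sB. Qed.

Lemma restr_perm_out s (B : {set 'I_n}) i : i \notin B -> restr_perm B s i = i.
Proof. exact: out_perm (restr_perm_on B s). Qed.

Lemma wt_act s a : wt (pin_vec (pin_act s a)) = wt (pin_vec a).
Proof.
rewrite /wt [RHS](reindex_perm s^-1); apply: eq_bigr => i _.
by rewrite pin_vec_act.
Qed.

(** Write a = z^d b b' with b supported on [B] and b' off [B]. The restricted permutation acts on b
    as [s] does and fixes b', so the two products differ only by exchanging s(b) and b'. Their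
    supports are disjoint and their weights are q and p + q, whence the exponent q (p + q) = q (p +
    1). *)
Lemma cycle_part_comm g a s (B : {set 'I_n}) (x := hgt g a s)
    (q := (\sum_(i in B) pin_vec a i)%R) :
  (forall i, (s i \in B) = (i \in B)) ->
  cycle_part g a s B * x = HGt_c (q * (wt (pin_vec a) + 1))%R * (x * cycle_part g a s B).
Proof.
move=> sB; have sN := restr_permN sB.
have sVB i : (s^-1 i \in B) = (i \in B) by rewrite -{2}(permKV s i) sB.
have rVE i : i \in B -> (restr_perm B s)^-1 i = s^-1 i.
  move=> iB; apply: (canLR (permK _)); rewrite restr_permE ?permKV //.
  by rewrite sVB.
have rVout i : i \notin B -> (restr_perm B s)^-1 i = i.
  by move=> iB; apply: (canLR (permK _)); rewrite restr_perm_out.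
apply/eqP/HGt_commP; split; first by rewrite restr_perm_commute.
  apply/ffunP=> i; rewrite !ffunE sVB; case: ifP => [iB|/negbT iB].
    by rewrite rVE.
  by rewrite mul1g mulg1 rVout.
set b := PinElt _ _; set b' := PinElt [ffun i => if i \in B then 0%R else pin_vec a i] 0%R.
have [d aE] : exists d, a = pin_c n d * (b * b').
  eexists; apply: pin_vec_inj; rewrite pin_vecM; apply/ffunP=> i; rewrite !ffunE.
  by case: ifP; rewrite ?addr0 ?add0r.
have rb : pin_act (restr_perm B s) b = pin_act s b.
  apply: pin_act_eq => i; rewrite ffunE; case: ifP => [iB _|]; last by rewrite eqxx.
  by rewrite restr_permE.
have rb' : pin_act (restr_perm B s) b' = b'.
  rewrite -[RHS]pin_act1; apply: pin_act_eq => i; rewrite ffunE perm1.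
  by case: ifP => [|/negbT iB _]; rewrite ?eqxx // restr_perm_out.
have -> : pin_act (restr_perm B s) a = pin_c n d * (pin_act s b * b').
  by rewrite aE !pin_actM pin_act_c rb rb'.
have key w K : w * b' = pin_c n K * (b' * w) ->
    b * (pin_c n d * (w * b')) = pin_c n K * (pin_c n d * (b * b') * w).
  move=> ->; rewrite !mulgA -[b * pin_c n d]pin_cC -[_ * b * pin_c n K]mulgA.
  by rewrite -[b * pin_c n K]pin_cC !mulgA -!pin_cD addrC.
rewrite [in X in _ = _ * (X * _)]aE; apply: key.
rewrite [LHS]pin_commE wt_act; congr (pin_c n _ * _).
have -> : wt (pin_vec b) = q.
  by rewrite /q [RHS]big_mkcond; apply: eq_bigr => i _; rewrite ffunE.
have -> : wt (pin_vec b') = (wt (pin_vec a) + q)%R.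
  rewrite /wt /q [X in (_ + X)%R]big_mkcond -big_split; apply: eq_bigr => i _ /=.
  by rewrite ffunE; case: ifP; rewrite ?addr0 ?Z2_addxx.
rewrite /dot big1 ?addr0; last first.
  move=> i _; rewrite pin_vec_act !ffunE sVB.
  by case: ifP; rewrite ?mulr0 ?mul0r.
have qq : (q * q = q)%R by case: (q) => [[|[|//]] ?]; exact/val_inj.
by rewrite !mulrDr qq mulr1.
Qed.

End Commutators.

(** * Iteration along cycles, partial cycle-products and their transport *)

Lemma iter_porbit_mod (T : finType) (s : {perm T}) j a :
  iter (a %% #|porbit s j|) s j = iter a s j.
Proof.
rewrite [in RHS](divn_eq a #|porbit s j|) addnC iterD.
by elim: (_ %/ _) => // q IH; rewrite mulSnr iterD iter_porbit.
Qed.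

Lemma eq_iter_porbit (T : finType) (s : {perm T}) j a b :
  (iter a s j == iter b s j) = (a == b %[mod #|porbit s j|]).
Proof.
have m0 : 0 < #|porbit s j| by rewrite lt0n card_porbit_neq0.
rewrite -(iter_porbit_mod s j a) -(iter_porbit_mod s j b).
have := uniq_traject_porbit s j.
move/uniqP => /(_ j) U; apply/eqP/eqP => [E|-> //].
apply: U; rewrite ?inE ?size_traject ?ltn_pmod //.
by rewrite !nth_traject ?ltn_pmod.
Qed.

Lemma porbit_iterP (T : finType) (s : {perm T}) i j :
  reflect (exists a, i = iter a s j) (i \in porbit s j).
Proof.
by apply: (iffP (porbitP s j i)) => -[a ->]; exists a; rewrite permX.
Qed.

Lemma porbit_iter (T : finType) (s : {perm T}) a j : porbit s (iter a s j) = porbit s j.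
Proof. by rewrite -permX porbit_perm. Qed.

Section PartialProducts.
Variables (T : finType) (gT : finGroupType) (k : T -> gT) (s : {perm T}).

Definition kprod i j := \prod_(l <- rev (traject s j i)) k l.

Lemma kprod0 j : kprod 0 j = 1. Proof. by rewrite /kprod big_nil. Qed.

Lemma kprodS i j : kprod i.+1 j = k (iter i s j) * kprod i j.
Proof. by rewrite /kprod trajectSr rev_rcons big_cons. Qed.

Lemma kprodD a b j : kprod (a + b) j = kprod a (iter b s j) * kprod b j.
Proof. by elim: a => [|a IH]; rewrite ?kprod0 ?mul1g // addSn !kprodS IH mulgA iterD. Qed.

End PartialProducts.

Section Transport.
Variables (T : finType) (gT : finGroupType) (k k' : T -> gT) (s s' t : {perm T}).
Variable f : T -> gT.
Hypotheses (ts : forall j, t (s j) = s' (t j))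
  (fk : forall j, f (s j) * k j = k' (t j) * f j).

Lemma transport_iter i j : t (iter i s j) = iter i s' (t j).
Proof. by elim: i => //= i IH; rewrite ts IH. Qed.

(** The relation [fk] telescopes: [f] moves through the product one factor at a time and turns each
    [k] into [k']. Over a full cycle [f] returns to its start, so the two cycle-products are
    conjugate under [f j]. *)
Lemma transport_kprod i j : f (iter i s j) * kprod k s i j = kprod k' s' i (t j) * f j.
Proof.
elim: i => [|i IH]; first by rewrite !kprod0 mulg1 mul1g.
by rewrite !kprodS iterS mulgA fk -mulgA IH mulgA transport_iter.
Qed.

Lemma transport_porbit j : porbit s' (t j) = t @: porbit s j.
Proof.
apply/setP=> i; apply/porbit_iterP/imsetP => [[a ->]|[l /porbit_iterP[a ->] ->]].
  by exists (iter a s j); [apply/porbit_iterP; exists a | rewrite transport_iter].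
by exists a; rewrite transport_iter.
Qed.

End Transport.

(* Each point of [T] is reached from a base point [b j] of its [s]-orbit; carrying
   the base points to [b' j] extends along the orbits because the cycle products
   at [b j] and [b' j] are conjugate under [C j]. *)
Lemma extend_transport (T : finType) (gT : finGroupType) (k k' : T -> gT)
    (s s' : {perm T}) (b b' : T -> T) (C : T -> gT) :
  (forall j, b (s j) = b j) -> (forall j, b' (s j) = b' j) ->
  (forall j, C (s j) = C j) -> (forall j, j \in porbit s (b j)) ->
  (forall j, #|porbit s' (b' j)| = #|porbit s (b j)|) ->
  (forall j (m := #|porbit s (b j)|),
     kprod k' s' m (b' j) * C j = C j * kprod k s m (b j)) ->
  (forall i j, porbit s' (b' i) = porbit s' (b' j) -> b i = b j /\ b' i = b' j) ->
  exists (t : {perm T}) (f : T -> gT), (forall j, t (s j) = s' (t j)) /\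
    (forall j, f (s j) * k j = k' (t j) * f j).
Proof.
move=> bs b's Cs jb cE CP binj.
have ex j : exists a, j == iter a s (b j) by have /porbit_iterP[a /eqP] := jb j; exists a.
pose e j := xchoose (ex j).
have eE j : iter (e j) s (b j) = j by apply/esym/eqP; exact: (xchooseP (ex j)).
pose t0 j := iter (e j) s' (b' j).
have t0_inj : injective t0.
  move=> i j E; have := congr1 (porbit s') E; rewrite /t0 !porbit_iter => /binj[bE b'E].
  move/eqP: E; rewrite /t0 b'E eq_iter_porbit cE -eq_iter_porbit -{1}bE !eE.
  by move/eqP.
(* The telescoped relation forces this value of [f] at the point reached after [a] steps, once it is
   [C j] at the base point. *)
pose F j a := kprod k' s' a (b' j) * C j * (kprod k s a (b j))^-1.
have FS j a : F j a.+1 * k (iter a s (b j)) = k' (iter a s' (b' j)) * F j a.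
  by rewrite /F !kprodS invMg !mulgA mulgKV.
(* Periodicity is where conjugacy of the cycle-products enters. It makes [F] depend on the point
   only, since exponents are determined only modulo the cycle length. *)
have Fmod j a (m := #|porbit s (b j)|) : F j a = F j (a %% m).
  rewrite [in LHS](divn_eq a m) addnC; elim: (_ %/ _) => [|q <-]; first by rewrite addn0.
  have i' : iter m s' (b' j) = b' j by rewrite /m -cE iter_porbit.
  rewrite mulSnr addnA [in LHS]/F (kprodD k' s' _ m) (kprodD k s _ m) i' iter_porbit.
  by rewrite -[_ * _ * C j]mulgA CP invMg !mulgA mulgK.
exists (perm t0_inj), (fun j => F j (e j)).
have eS j : (e (s j) == (e j).+1 %[mod #|porbit s (b j)|]).
  by rewrite -eq_iter_porbit -{1}(bs j) eE iterS eE.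
split=> j; rewrite ?permE /t0.
  by apply/eqP; rewrite b's -iterS eq_iter_porbit cE.
have -> : F (s j) (e (s j)) = F j (e j).+1.
  by rewrite /F bs b's Cs -!/(F j _) Fmod (eqP (eS j)) -Fmod.
by have := FS j (e j); rewrite eE.
Qed.

(** * Types as complete conjugacy invariants of [HG] *)

Section Wreath.
Variables (G : finGroupType) (n : nat).
Implicit Types (x y : HG G n) (s t : 'S_n) (k h : {ffun 'I_n -> G * 'Z_2}) (O : {set 'I_n}).

Definition hg k s : HG G n := Semidirect (ffun_action n (G * 'Z_2)%type) k s.

Lemma kprod_cycle x j (s := sd_perm x) :
  kprod (sd_ker x) s #|porbit s j| j = (cycle_prod x j, cycle_sgn x (porbit s j)).
Proof.
rewrite /kprod /cycle_prod /cycle_sgn.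
rewrite (eq_bigl _ _ (porbit_traject s j)) -(big_uniq _ (uniq_traject_porbit s j)) /=.
rewrite [X in (_, X)](perm_big (rev (traject s j #|porbit s j|))); last first.
  by rewrite perm_sym perm_rev.
by elim/big_rec3: _ => // i a b p _ ->.
Qed.

(** With [f j = h (t (s^-1 j))] the second condition becomes the relation
    [f (s j) * k j = k' (t j) * f j] used for transport. *)
Lemma HG_conjP k s k' s' h t : 
  hg h t * hg k s = hg k' s' * hg h t <->
  (forall j, t (s j) = s' (t j)) /\
  (forall j, h (t j) * k j = k' (t j) * h (t (s^-1 j))).
Proof.
rewrite !sdM /sd_mul /=; split => [[E1 E2]|[E2 E1]].
  have ts j : t (s j) = s' (t j) by move/permP/(_ j): E2; rewrite !permM.
  split=> // j; move/ffunP/(_ (t j)): E1; rewrite !ffunE permK => ->.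
  by congr (_ * h _); apply: (canLR (permK _)); rewrite -ts permKV.
congr Semidirect; last by apply/permP=> j; rewrite !permM.
apply/ffunP=> i; rewrite !ffunE; have := E1 (t^-1 i); rewrite permKV => ->.
by congr (_ * h _); apply/esym/(canLR (permK _)); rewrite -E2 !permKV.
Qed.

(** On a cycle all cycle-products are conjugate, so the union is a single class; it avoids the
    choice of a starting point. *)
Definition orbit_class x (O : {set 'I_n}) : {set G} :=
  \bigcup_(j in O) cycle_prod x j ^: [set: G].
Definition label x O := (#|O|, cycle_sgn x O, orbit_class x O).

Lemma cycle_prod_class x i j : i \in porbit (sd_perm x) j ->
  cycle_prod x i ^: [set: G] = cycle_prod x j ^: [set: G].
Proof.
case/porbit_iterP=> a ->; elim: a => //= a <-; rewrite cycle_prod_perm.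
by rewrite classGidl ?inE.
Qed.

Lemma orbit_classE x j : orbit_class x (porbit (sd_perm x) j) = cycle_prod x j ^: [set: G].
Proof.
apply/setP=> g; apply/bigcupP/idP => [[i /cycle_prod_class -> //]|gj].
by exists j; rewrite ?porbit_id.
Qed.

Lemma cycle_multE x e c i : c \in classes [set: G] ->
  cycle_mult x e c i = #|[set O in porbits (sd_perm x) | label x O == (i, e, c)]|.
Proof.
move=> /imsetP[g _ ->]; apply: eq_card => O; rewrite !inE.
case Os: (O \in _) => //=; case/imsetP: Os => j _ ->.
rewrite /label !xpair_eqE orbit_classE -andbA; congr (_ && (_ && _)).
apply/existsP/eqP => [[l /andP[lO]]|E].
  by move/class_eqP; rewrite (cycle_prod_class lO).
by exists j; rewrite porbit_id -E class_refl.
Qed.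

Lemma label_transport x x' y j : y * x = x' * y ->
  label x' (sd_perm y @: porbit (sd_perm x) j) = label x (porbit (sd_perm x) j).
Proof.
case: x x' y => [k s] [k' s'] [h t] /HG_conjP[ts hk] /=.
have fk i : (fun l => h (t (s^-1 l))) (s i) * k i = k' (t i) * (fun l => h (t (s^-1 l))) i.
  by rewrite /= permK hk.
have := transport_kprod ts fk #|porbit s j| j.
rewrite (iter_porbit s j) -(transport_porbit ts).
have cE : #|porbit s' (t j)| = #|porbit s j|.
  by rewrite (transport_porbit ts) card_imset //; exact: perm_inj.
rewrite -{2}cE (kprod_cycle (hg k s)) (kprod_cycle (hg k' s')) /= => E12.
have E1 := congr1 fst E12; have E2 := congr1 snd E12; rewrite /= in E1 E2.
rewrite /label cE (orbit_classE (hg k s)) (orbit_classE (hg k' s')).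
congr (_, _, _).
  apply: (@addIr _ (h (t (s^-1 j))).2); rewrite [RHS]addrC; exact: (esym E2).
rewrite -[RHS](classGidl _ (_ : (h (t (s^-1 j))).1^-1 \in setT)) ?inE //.
congr (_ ^: _); rewrite /conjg invgK; apply: (mulIg (h (t (s^-1 j))).1).
by rewrite -E1 mulgA mulgKV.
Qed.

Lemma card_label_transport x x' y v : y * x = x' * y ->
  #|[set O in porbits (sd_perm x') | label x' O == v]| =
  #|[set O in porbits (sd_perm x) | label x O == v]|.
Proof.
move=> E; have Es j : sd_perm y (sd_perm x j) = sd_perm x' (sd_perm y j).
  by case: x x' y E => [k s] [k' s'] [h t] /HG_conjP[].
have oE j : porbit (sd_perm x') (sd_perm y j) = sd_perm y @: porbit (sd_perm x) j.
  exact: transport_porbit.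
rewrite -[RHS](card_imset _ (imset_inj (@perm_inj _ (sd_perm y)))); apply: eq_card => O.
rewrite inE; apply/andP/imsetP => [[/imsetP[i _ ->]]|[O']].
  rewrite -(permKV (sd_perm y) i) oE label_transport // => lE.
  by exists (porbit (sd_perm x) ((sd_perm y)^-1 i)); rewrite // inE lE imset_f.
rewrite inE => /andP[/imsetP[i _ ->] lE] ->.
by rewrite (label_transport _ E) lE -oE imset_f.
Qed.

Lemma eq_mult_part N m m' : m =1 m' -> mult_part N m = mult_part N m'.
Proof.
move=> E; apply/val_inj; congr flatten; apply: eq_map => i; congr nseq; exact: E.
Qed.

Lemma htype_conj x x' y : y * x = x' * y -> htype x' = htype x.
Proof.
move=> E; congr (_, _); apply/ffunP=> c; rewrite !ffunE; apply: eq_mult_part => i;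
  by rewrite !cycle_multE ?(valP c) // (card_label_transport _ E).
Qed.

Lemma htype_cycle_mult x x' e (c : conj_classes G) i : htype x = htype x' -> 0 < i <= n ->
  cycle_mult x e (val c) i = cycle_mult x' e (val c) i.
Proof.
move=> E iP; have {}E : htype_sgn x e = htype_sgn x' e.
  case: E; case: e => [[|[|//]] eP] E0 E1.
    by rewrite (_ : Ordinal eP = 0%R) //; exact: val_inj.
  by rewrite (_ : Ordinal eP = 1%R) //; exact: val_inj.
move/ffunP/(_ c)/(congr1 (fun r : intpart => count_mem i r)): E.
by rewrite !ffunE !count_mult_part.
Qed.

(** An element goes to the element of [B] that has the same label and the same rank among the
    elements with that label. Equal counts keep the rank within range, so the default of [nth] is
    never returned. *)
Lemma match_labels (T : finType) (L : eqType) (A B : {set T}) (la lb : T -> L) :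
  (forall o, o \in A ->
     #|[set o' in A | la o' == la o]| = #|[set o' in B | lb o' == la o]|) ->
  exists phi : T -> T, {in A &, injective phi} /\
    {in A, forall o, phi o \in B /\ lb (phi o) = la o}.
Proof.
move=> cE; pose EA o := enum [set o' in A | la o' == la o].
pose EB o := enum [set o' in B | lb o' == la o].
have ix o : o \in A -> index o (EA o) < size (EB o).
  by move=> oA; rewrite -cardE -cE // cardE index_mem mem_enum inE oA eqxx.
exists (fun o => nth o (EB o) (index o (EA o))).
have phiP o : o \in A -> nth o (EB o) (index o (EA o)) \in B /\
    lb (nth o (EB o) (index o (EA o))) = la o.
  by move=> /ix /(mem_nth o); rewrite mem_enum inE => /andP[-> /eqP].
split=> // o1 o2 o1A o2A E.
have lE : la o1 = la o2 by rewrite -(phiP _ o1A).2 E (phiP _ o2A).2.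
have [EAE EBE] : EA o1 = EA o2 /\ EB o1 = EB o2 by rewrite /EA /EB lE.
have := ix _ o1A; have := ix _ o2A; rewrite EAE EBE in E * => i2 i1.
rewrite (set_nth_default o2) // in E.
have /eqP := E; rewrite nth_uniq ?enum_uniq // => /eqP.
have o1E : o1 \in EA o2 by rewrite -EAE mem_enum inE o1A eqxx.
by move/(congr1 (nth o2 (EA o2))); rewrite !nth_index // mem_enum inE o2A eqxx.
Qed.

Lemma conj_htype x x' : htype x = htype x' -> exists y, y * x = x' * y.
Proof.
case: x x' => [k s] [k' s'] hE; set x := hg k s; set x' := hg k' s'.
have lE O : O \in porbits s -> #|[set O' in porbits s | label x O' == label x O]| =
    #|[set O' in porbits s' | label x' O' == label x O]|.
  case/imsetP=> j _ ->.
  have -> : label x (porbit s j) =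
      (#|porbit s j|, cycle_sgn x (porbit s j), cycle_prod x j ^: [set: G]).
    by rewrite /label (orbit_classE x).
  have cG : cycle_prod x j ^: [set: G] \in classes [set: G].
    by apply: mem_classes; rewrite inE.
  rewrite -(cycle_multE x) // -(cycle_multE x') //.
  apply: (htype_cycle_mult _ (exist (fun C => C \in classes [set: G]) _ cG) hE).
  by rewrite lt0n card_porbit_neq0 -[X in _ <= X]card_ord max_card.
have [phi [phi_inj phiP]] := match_labels lE.
have pO j : porbit s j \in porbits s by exact: imset_f.
(* The chosen point depends on the set alone when the set is nonempty; the default [j] covers only
   the empty set. *)
pose pk (O : {set 'I_n}) j := odflt j [pick i in O].
have pkP O j : j \in O -> forall i, pk O i \in O.
  by move=> jO i; rewrite /pk; case: pickP => [//|/(_ j)]; rewrite jO.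
have pkE O j i l : j \in O -> pk O i = pk O l.
  by move=> jO; rewrite /pk; case: pickP => [//|/(_ j)]; rewrite jO.
pose b j := pk (porbit s j) j; pose b' j := pk (phi (porbit s j)) j.
have bP j : b j \in porbit s j by exact: pkP (porbit_id s j) _.
have bE j : porbit s (b j) = porbit s j by apply/eqP; rewrite eq_porbit_mem.
have b'P j : b' j \in phi (porbit s j).
  have [/imsetP[i _ E] _] := phiP _ (pO j); by apply: (pkP _ i); rewrite E porbit_id.
have b'E j : porbit s' (b' j) = phi (porbit s j).
  have [/imsetP[i _ E] _] := phiP _ (pO j); rewrite E.
  by apply/eqP; rewrite eq_porbit_mem -E.
have bE2 i j : porbit s i = porbit s j -> b i = b j /\ b' i = b' j.
  rewrite /b /b' => E; rewrite E; split; first exact: pkE (porbit_id s j).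
  by apply: (pkE _ (b' j)); exact: b'P.
have sE j : porbit s (s j) = porbit s j by exact: (porbit_iter s 1).
have labE j : label x' (porbit s' (b' j)) = label x (porbit s (b j)).
  by rewrite b'E bE; case: (phiP _ (pO j)).
(* The conjugator is picked from [b j] and [b' j] only, so that it is constant along cycles.
   Equality of labels provides one, so the default 1 is never taken. *)
pose c j := odflt 1 [pick g | cycle_prod x' (b' j) == cycle_prod x (b j) ^ g].
have cP j : cycle_prod x' (b' j) = cycle_prod x (b j) ^ c j.
  have : cycle_prod x' (b' j) \in cycle_prod x (b j) ^: [set: G].
    have [_ <-] : cycle_sgn x' (porbit s' (b' j)) = cycle_sgn x (porbit s (b j)) /\
       cycle_prod x' (b' j) ^: [set: G] = cycle_prod x (b j) ^: [set: G].
      by rewrite -(orbit_classE x) -(orbit_classE x'); case: (labE j).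
    exact: class_refl.
  case/imsetP=> g _ E; rewrite /c; case: pickP => [? /eqP //|/(_ g)].
  by rewrite E eqxx.
have [t [f [ts fk]]] : exists (t : 'S_n) (f : 'I_n -> G * 'Z_2),
    (forall j, t (s j) = s' (t j)) /\ (forall j, f (s j) * k j = k' (t j) * f j).
  pose C j : G * 'Z_2 := ((c j)^-1, 0%R).
  apply: (@extend_transport _ (G * 'Z_2)%type k k' s s' b b' C) => j.
  - by have [] := bE2 _ _ (sE j).
  - by have [] := bE2 _ _ (sE j).
  - by have [bs b's] := bE2 _ _ (sE j); rewrite /C /c bs b's.
  - by rewrite porbit_sym.
  - by case: (labE j).
  - have [mE sgE] : #|porbit s' (b' j)| = #|porbit s (b j)| /\
       cycle_sgn x' (porbit s' (b' j)) = cycle_sgn x (porbit s (b j)).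
      by case: (labE j).
    have := kprod_cycle x' (b' j); have := kprod_cycle x (b j); rewrite /= mE.
    move=> -> ->; rewrite cP sgE; congr pair.
      by rewrite /= /conjg mulgA mulgK.
    exact: (etrans (addr0 _) (esym (add0r _))).
  - move=> l; rewrite !b'E => /(phi_inj _ _ (pO j) (pO l)); exact: bE2.
(* This inverts the substitution [f j = h (t (s^-1 j))]. *)
exists (hg [ffun i => f (s (t^-1 i))] t); apply/HG_conjP; split=> // j.
by rewrite !ffunE permK fk !permK permKV.
Qed.

End Wreath.

(** * A normal form with one cycle for each index in [W] *)

Section NormalForm.
Variables (G : finGroupType) (n : nat) (W : finType) (len : W -> nat).
Variable (lab : W -> conj_classes G * 'Z_2).
Hypothesis len_gt0 : forall w, 0 < len w.
Local Notation T := {w : W & 'I_(len w)}.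
Variables (f : 'I_n -> T) (f' : T -> 'I_n).
Hypotheses (fK : cancel f f') (f'K : cancel f' f).

Definition nf_cycle (j : 'I_n) : W := tag (f j).
Definition nf_pos (j : 'I_n) : nat := tagged (f j).
Definition nf_base (w : W) : 'I_n :=
  f' (Tagged (fun w => 'I_(len w)) (Ordinal (len_gt0 w))).

Lemma nf_pos_lt j : nf_pos j < len (nf_cycle j). Proof. exact: ltn_ord. Qed.

Lemma nf_inj i j : nf_cycle i = nf_cycle j -> nf_pos i = nf_pos j -> i = j.
Proof.
rewrite /nf_cycle /nf_pos => wE pE; apply: (can_inj fK).
case: (f i) (f j) wE pE => [w a] [w' b] /= wE; case: w' / wE b => b /val_inj -> //.
Qed.

Definition nf_rot (p : T) : T := Tagged (fun w => 'I_(len w)) (ordS (tagged p)).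

Lemma nf_rot_inj : injective (f' \o nf_rot \o f).
Proof.
move=> i j /= /(can_inj f'K); move=> E; apply: (can_inj fK).
case: (f i) (f j) E => [w a] [w' b] E.
have wE : w = w' by exact: (congr1 tag E).
case: w' / wE b E => b E; congr Tagged; apply: ordS_inj.
by apply: val_inj; exact: (congr1 (fun p : T => val (tagged p)) E).
Qed.

Definition nf_perm : 'S_n := perm nf_rot_inj.

Lemma nf_cycle_base w : nf_cycle (nf_base w) = w.
Proof. by rewrite /nf_cycle f'K. Qed.

Lemma nf_pos_base w : nf_pos (nf_base w) = 0%N.
Proof. by rewrite /nf_pos f'K. Qed.

Lemma nf_iter a j (i := iter a nf_perm j) :
  nf_cycle i = nf_cycle j /\ nf_pos i = (nf_pos j + a) %% len (nf_cycle j).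
Proof.
rewrite {}/i; elim: a => [|a [IHc IHp]] /=; first by rewrite addn0 modn_small ?nf_pos_lt.
set i := iter _ _ _ in IHc IHp *.
have sc : nf_cycle (nf_perm i) = nf_cycle i by rewrite /nf_cycle permE /= f'K.
have sp : nf_pos (nf_perm i) = (nf_pos i).+1 %% len (nf_cycle i).
  by rewrite /nf_pos permE /= f'K.
by rewrite sc sp IHc IHp -addn1 modnDml addn1 addnS.
Qed.

Lemma nf_iter_base j : iter (nf_pos j) nf_perm (nf_base (nf_cycle j)) = j.
Proof.
have [c p] := nf_iter (nf_pos j) (nf_base (nf_cycle j)).
apply: nf_inj; rewrite ?c ?p nf_cycle_base // nf_pos_base add0n.
by rewrite modn_small ?nf_pos_lt.
Qed.

Lemma mem_nf_porbit i j : (i \in porbit nf_perm j) = (nf_cycle i == nf_cycle j).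
Proof.
apply/porbit_iterP/eqP => [[a ->]|E]; first by have [] := nf_iter a j.
apply/porbit_iterP; rewrite -(nf_iter_base i) -(nf_iter_base j) -eq_porbit_mem.
by rewrite !porbit_iter E.
Qed.

(** Both numbers have the same multiples, namely the exponents [a] for which the [a]-th iterate
    fixes [j]. *)
Lemma card_nf_porbit j : #|porbit nf_perm j| = len (nf_cycle j).
Proof.
have key a : (#|porbit nf_perm j| %| a) = (len (nf_cycle j) %| a).
  have -> : (#|porbit nf_perm j| %| a) = (iter a nf_perm j == iter 0 nf_perm j).
    by rewrite eq_iter_porbit mod0n.
  have [c p] := nf_iter a j; apply/eqP/idP => [E|la].
    have : nf_pos j + 0 == nf_pos j + a %[mod len (nf_cycle j)].
      by rewrite addn0 -p E /= modn_small ?nf_pos_lt.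
    by rewrite eqn_modDl mod0n eq_sym.
  apply: nf_inj => //; rewrite p -modnDmr (eqP la) addn0 modn_small ?nf_pos_lt //.
by apply/eqP; rewrite eqn_dvd key dvdnn -key dvdnn.
Qed.

Definition nf_ker : {ffun 'I_n -> G * 'Z_2} :=
  [ffun j => if nf_pos j == 0%N
             then (repr (val (lab (nf_cycle j)).1), (lab (nf_cycle j)).2) else (1, 0%R)].

Definition nf : HG G n := hg nf_ker nf_perm.

Lemma kprod_nf a w : a < len w ->
  kprod nf_ker nf_perm a.+1 (nf_base w) = (repr (val (lab w).1), (lab w).2).
Proof.
elim: a => [|a IH] aw.
  by rewrite kprodS kprod0 mulg1 ffunE nf_pos_base nf_cycle_base.
rewrite kprodS IH; last exact: ltnW.
have [c p] := nf_iter a.+1 (nf_base w).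
rewrite nf_cycle_base nf_pos_base add0n modn_small // in c p.
by rewrite ffunE p /=; exact: mul1g.
Qed.

Lemma label_nf w :
  label nf (porbit nf_perm (nf_base w)) = (len w, (lab w).2, val (lab w).1).
Proof.
rewrite /label card_nf_porbit nf_cycle_base (orbit_classE nf).
have lw : (len w).-1 < len w by rewrite prednK.
have := kprod_nf lw; rewrite prednK //.
have := kprod_cycle nf (nf_base w); rewrite /= card_nf_porbit nf_cycle_base => -> E.
have -> : cycle_prod nf (nf_base w) = repr (val (lab w).1) by exact: (congr1 fst E).
have -> : cycle_sgn nf (porbit nf_perm (nf_base w)) = (lab w).2 by exact: (congr1 snd E).
by have /repr_classesP[_ <-] := valP (lab w).1.
Qed.

Lemma cycle_mult_nf e (c : conj_classes G) i :
  cycle_mult nf e (val c) i = #|[set w | (len w == i) && (lab w == (c, e))]|.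
Proof.
rewrite cycle_multE ?(valP c) //.
rewrite -[RHS](card_imset (f := fun w => porbit nf_perm (nf_base w))); last first.
  by move=> w w' /eqP; rewrite eq_porbit_mem mem_nf_porbit !nf_cycle_base => /eqP.
have labE w : (label nf (porbit nf_perm (nf_base w)) == (i, e, val c)) =
    (len w == i) && (lab w == (c, e)).
  rewrite label_nf !xpair_eqE -andbA; congr (_ && _); rewrite andbC.
  by case: (lab w) => c' e'; rewrite xpair_eqE.
apply: eq_card => O; rewrite inE; apply/andP/imsetP => [[/imsetP[j _ ->]]|[w]].
  rewrite -(nf_iter_base j) porbit_iter labE => E.
  by exists (nf_cycle j); rewrite // inE.
by rewrite inE -labE => E ->; rewrite E imset_f.
Qed.

(** Only base points carry a sign, and each cycle has exactly one base point. *)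
Lemma parity_nf : parity nf = (#|[set w | (lab w).2 == 1%R]|%:R)%R.
Proof.
rewrite /parity /= -sum1_card natr_sum.
rewrite [RHS](reindex_onto nf_cycle nf_base) /=; last by move=> w _; rewrite nf_cycle_base.
rewrite [RHS]big_mkcond; apply: eq_bigr => j _; rewrite inE ffunE.
have -> : (nf_base (nf_cycle j) == j) = (nf_pos j == 0%N).
  apply/eqP/eqP => [<-|p]; first exact: nf_pos_base.
  by apply: nf_inj; rewrite ?nf_cycle_base ?nf_pos_base.
case: (_ == 0%N); rewrite ?andbF //= andbT.
by case: (lab _) => c [[|[|//]] eP]; apply/val_inj.
Qed.

(** Sending each position on [w] to the same position on [sg w] commutes with rotation because the
    two cycles have equal length. *)
Lemma nf_permute (sg : {perm W}) : (forall w, len (sg w) = len w) ->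
  exists t : 'S_n, (forall j, t (nf_perm j) = nf_perm (t j)) /\
    forall j, nf_cycle (t j) = sg (nf_cycle j) /\ nf_pos (t j) = nf_pos j.
Proof.
move=> lsg; pose t0 j := iter (nf_pos j) nf_perm (nf_base (sg (nf_cycle j))).
have t0P j : nf_cycle (t0 j) = sg (nf_cycle j) /\ nf_pos (t0 j) = nf_pos j.
  have [c p] := nf_iter (nf_pos j) (nf_base (sg (nf_cycle j))).
  rewrite nf_cycle_base nf_pos_base add0n lsg modn_small ?nf_pos_lt // in c p.
have t0_inj : injective t0.
  move=> i j E; have [ci pi_] := t0P i; have [cj pj] := t0P j.
  by apply: nf_inj; [apply: (@perm_inj _ sg); rewrite -ci -cj E | rewrite -pi_ -pj E].
have tE : perm t0_inj =1 t0 by exact: permE.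
exists (perm t0_inj); split=> j; rewrite !tE; last exact: t0P.
have [c p] := nf_iter 1 j; have [c' p'] := nf_iter 1 (t0 j); rewrite /= in c p c' p'.
by apply: nf_inj; rewrite ?c' ?p' !(t0P _).1 ?(t0P _).2 ?c ?p // lsg.
Qed.

Lemma nf_ker_base j : (nf_ker j).2 != 0%R -> j = nf_base (nf_cycle j).
Proof.
rewrite ffunE; case: (nf_pos j =P 0%N) => [p _|]; last by rewrite eqxx.
by apply: nf_inj; rewrite ?nf_cycle_base ?nf_pos_base.
Qed.

End NormalForm.

(** * Splitting as a commutator condition *)

Section Splitting.
Variables (G : finGroupType) (n : nat).
Implicit Types (x y : HGt G n) (g h : {ffun 'I_n -> G}) (a b : Pin n) (s t : 'S_n).

Lemma theta_c c : theta (HGt_c G n c) = 1.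
Proof. by congr Semidirect; apply/ffunP=> i; rewrite !ffunE. Qed.

Lemma thetaM x y : theta (x * y) = theta x * theta y.
Proof. by apply: theta_morphM; rewrite inE. Qed.

Lemma theta_inj_z x y : theta x = theta y -> exists c, x = HGt_c G n c * y.
Proof.
case: x y => [[g a] s] [[h b] t] E.
have gE : g = h.
  apply/ffunP=> i; move/(congr1 (fun z : HG G n => (sd_ker z i).1)): E.
  by rewrite /= !ffunE.
have aE : pin_vec a = pin_vec b.
  apply/ffunP=> i; move/(congr1 (fun z : HG G n => (sd_ker z i).2)): E.
  by rewrite /= !ffunE.
have -> : s = t by exact: (congr1 (fun z : HG G n => sd_perm z) E).
exists (pin_sgn a + pin_sgn b)%R; rewrite -/(hgt h b t) HGt_cM gE.
by rewrite -(pin_vec_inj aE).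
Qed.

Lemma parity_theta g a s : parity (theta (hgt g a s)) = wt (pin_vec a).
Proof. by apply: eq_bigr => i _; rewrite ffunE. Qed.

Lemma cycle_sgn_theta g a s (O : {set 'I_n}) :
  cycle_sgn (theta (hgt g a s)) O = (\sum_(i in O) pin_vec a i)%R.
Proof. by apply: eq_bigr => i _; rewrite ffunE. Qed.

(** This is y x y^-1 = z x, written without inverses. *)
Definition nonsplit x := exists y, y * x = HGt_c G n 1%R * (x * y).

(** Every element over the class is conjugate to x or to z x, because types decide conjugacy below.
    The preimage is thus the union of the classes of x and z x, and these coincide exactly when x is
    not split. *)
Lemma class_splitsP rp rm x : htype (theta x) = (rp, rm) ->
  class_splits (type_class n rp rm) <-> ~ nonsplit x.
Proof.
move=> hx; set C := type_class n rp rm.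
have inC y : (y \in (@theta G n) @^-1: C) = (htype (theta y) == (rp, rm)) by rewrite !inE.
have CP y : y \in (@theta G n) @^-1: C -> exists c v, y = HGt_c G n c * x ^ v.
  rewrite inC -hx => /eqP /esym /conj_htype [w wE].
  have [v vw] : exists v, theta v = w.
    have : w \in (@theta G n) @* [set: HGt G n] by rewrite theta_surj inE.
    by case/imsetP=> v _ ->; exists v.
  have : theta y = theta (x ^ v^-1).
    rewrite /conjg invgK; apply: (mulIg w).
    by rewrite -{2}vw -wE -vw -!thetaM !mulgA mulgKV.
  by case/theta_inj_z=> c ->; exists c, v^-1.
have inC_conj c v : HGt_c G n c * x ^ v \in (@theta G n) @^-1: C.
  rewrite inC -hx; apply/eqP; rewrite thetaM theta_c mul1g.
  by apply: (@htype_conj _ _ _ _ (theta v^-1)); rewrite -!thetaM /conjg !mulgA mulgK.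
have cJ c v : (HGt_c G n c * x) ^ v = HGt_c G n c * x ^ v.
  by rewrite /conjg !mulgA HGt_cC.
have c01 (c : 'Z_2) : c = 0%R \/ c = 1%R.
  by case: c => [[|[|//]] ?]; [left | right]; exact/val_inj.
split=> [[D1 [D2 [/imsetP[x1 _ D1E] /imsetP[x2 _ D2E] D12 DE]]] [y yx] | ns].
  have zx : HGt_c G n 1%R * x = x ^ y^-1.
    by rewrite /conjg invgK [y * _]mulgA yx -!mulgA mulgV mulg1.
  (* If z x is conjugate to x, the whole preimage is one class, and [D1] and [D2] cannot differ. *)
  have all v : v \in (@theta G n) @^-1: C -> v \in x ^: [set: HGt G n].
    case/CP=> c [w ->]; have [->|->] := c01 c; first by rewrite mul1g memJ_class ?inE.
    by rewrite -cJ zx -conjgM memJ_class ?inE.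
  have D1x : D1 = x ^: [set: HGt G n].
    rewrite D1E; apply/class_eqP/all; rewrite DE inE D1E class_refl; reflexivity.
  have D2x : D2 = x ^: [set: HGt G n].
    rewrite D2E; apply/class_eqP/all; rewrite DE inE D2E class_refl orbT; reflexivity.
  by rewrite D1x D2x eqxx in D12.
exists (x ^: [set: HGt G n]), ((HGt_c G n 1%R * x) ^: [set: HGt G n]).
split; rewrite ?mem_classes ?inE //.
  apply/negP=> /eqP E; apply: ns.
  have /imsetP[v _ vE] : HGt_c G n 1%R * x \in x ^: [set: HGt G n] by rewrite E class_refl.
  by exists v^-1; rewrite mulgA vE /conjg !mulgA mulgK.
apply/setP=> y; rewrite [RHS]inE; apply/idP/orP => [/CP[c [v ->]]|].
  have [->|->] := c01 c; [left; rewrite mul1g | right; rewrite -cJ];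
    by rewrite memJ_class ?inE.
case=> /imsetP[v _ ->]; last by rewrite cJ.
by rewrite -[x ^ v]mul1g -HGt_c0 inC_conj.
Qed.

(** * Centralizing an odd element all of whose cycles are odd *)

Section Centralizer.
Variables (g : {ffun 'I_n -> G}) (a : Pin n) (s : 'S_n).
Let x := hgt g a s.
Hypothesis odd_x : wt (pin_vec a) = 1%R.
Hypothesis odd_cycles : forall j, (\sum_(i in porbit s j) pin_vec a i)%R = 1%R.

(** Such a [b] is, up to a power of z, a product of [pin_seq] elements of whole cycles. Each of
    these commutes with x, since m (1 + 1) + 1 + 1 = 0. The induction removes one cycle at a time
    from the support. *)
Lemma pin_centralizer b : (forall j, pin_vec b (s j) = pin_vec b j) ->
  a * pin_act s b = b * a.
Proof.
have [m] := ubnP #|[set j | pin_vec b j != 0%R]|; elim: m b => // m IH b bm bs.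
have [[j bj]|/negP b0] := altP (set0Pn [set j | pin_vec b j != 0%R]); last first.
  have -> : b = pin_c n (pin_sgn b).
    case: b {bm bs} b0 => v c /negP; rewrite negbK => /eqP/setP b0.
    congr PinElt; apply/ffunP=> j.
    by have := b0 j; rewrite !inE => /negbFE/eqP ->; rewrite ffunE.
  by rewrite pin_act_c pin_cC.
rewrite inE in bj.
have E1 c : c != 0%R -> c = 1%R :> 'Z_2 by case: c => [[|[|//]] ?] // _; exact/val_inj.
pose r := traject s j #|porbit s j|.
have aj : a * pin_act s (pin_seq r) = pin_seq r * a.
  have /eqP/HGt_commP[_ _] := cycle_a_comm g a s j.
  rewrite pin_act1 odd_x odd_cycles Z2_addxx mulr0 add0r Z2_addxx -/r => ->.
  by rewrite mul1g.
have bO i : i \in porbit s j -> pin_vec b i = 1%R.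
  move=> /porbit_iterP[k ->]; elim: k => [|k IHk]; first exact: E1.
  by rewrite iterS bs.
have vs i : pin_vec (pin_seq r) i = (i \in porbit s j)%:R%R.
  by rewrite pin_seq_vec ?uniq_traject_porbit // porbit_traject.
have sO i : (s i \in porbit s j) = (i \in porbit s j).
  by rewrite -!eq_porbit_mem (porbit_iter s 1 i).
pose b' := pin_seq r * b.
have vb' i : pin_vec b' i = if i \in porbit s j then 0%R else pin_vec b i.
  rewrite pin_vecM ffunE vs; case: ifP => [/bO ->|_]; last by rewrite add0r.
  exact: Z2_addxx.
have b'E : a * pin_act s b' = b' * a.
  apply: IH; last by move=> i; rewrite !vb' sO bs.
  rewrite -ltnS; apply: leq_trans bm; rewrite ltnS; apply: proper_card.
  apply/properP; split.
    by apply/subsetP=> i; rewrite !inE vb'; case: ifP => //; rewrite eqxx.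
  by exists j; rewrite inE ?vb' ?porbit_id ?eqxx.
move: b'E; rewrite /b' pin_actM mulgA aj -!mulgA; exact: mulgI.
Qed.

(** On each cycle [t] agrees with a power of [s]. Multiplying by the inverse of that power of
    [cycle_part], which commutes with x as p = 1, clears the cycle without changing [c]. The
    induction on the points moved ends at [t = 1]. *)
Lemma odd_commutator c h b t : t * s = s * t -> (forall j, t j \in porbit s j) ->
  hgt h b t * x = HGt_c G n c * (x * hgt h b t) -> c = 0%R.
Proof.
have [m] := ubnP #|[set j | t j != j]|; elim: m h b t => // m IH h b t tm ts tO E.
have [[j tj]|/negP t0] := altP (set0Pn [set j | t j != j]); last first.
  have t1 : t = 1.
    apply/permP=> j; rewrite perm1; apply/eqP/negbNE/negP=> tj; apply: t0.
    by apply/set0Pn; exists j; rewrite inE.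
  subst t; move/eqP/HGt_commP: E => [_ _]; rewrite pin_act1 => E.
  (* Modulo z the [Pin n] coordinate of the relation says that [s] fixes the image of [b]. *)
  have bs j : pin_vec b (s j) = pin_vec b j.
    move/(congr1 (fun d : Pin n => pin_vec d (s j))): E.
    rewrite pin_cM (pin_vecM b) -[pin_vec (PinElt _ _)]/(pin_vec (a * _)) (pin_vecM a).
    rewrite ffunE [X in _ = X -> _]ffunE pin_vec_act permK addrC.
    exact: addrI.
  by move: E; rewrite pin_centralizer // -{1}[b * a]mul1g => /mulIg/pin_c_inj.
rewrite inE in tj; have /porbit_iterP[k tjE] := tO j.
pose O := porbit s j; pose sO := restr_perm O s; pose X := cycle_part g a s O.
have sOO i : (s i \in O) = (i \in O).
  by rewrite /O -!eq_porbit_mem (porbit_iter s 1 i).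
have Xx : X * x = x * X.
  by rewrite cycle_part_comm // odd_x Z2_addxx mulr0 mul1g.
have XkP : sd_perm (X ^+ k)^-1 = (sO ^+ k)^-1.
  congr (_^-1); elim: k {tjE} => // k IHk; by rewrite expgS sdM /= IHk expgSr.
have Xkx : (X ^+ k)^-1 * x = x * (X ^+ k)^-1.
  have : commute x (X ^+ k) by apply: commuteX.
  by move/commuteV.
(* Since [t] commutes with [s], its value at [j] determines it on the whole cycle. *)
have tOE i : i \in O -> t i = (sO ^+ k) i.
  case/porbit_iterP=> l ->{i}.
  have -> : t (iter l s j) = iter l s (t j).
    by elim: l => //= l <-; rewrite -!permM ts.
  rewrite tjE -iterD addnC iterD; set i := iter l s j.
  have iO : i \in O by apply/porbit_iterP; exists l.
  rewrite permX; elim: k {tjE XkP Xkx} => //= k <-.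
  rewrite restr_permE ?restr_permN //.
  by elim: k => //= k IHk; rewrite sOO.
have tout i : i \notin O -> (sO ^+ k)^-1 i = i.
  move=> iO; apply: (canLR (permK _)).
  rewrite permX; elim: k {tjE XkP Xkx tOE} => //= k <-.
  by rewrite restr_perm_out.
have tin i : i \in O -> t ((sO ^+ k)^-1 i) = i.
  move=> iO; rewrite tOE ?permKV //; apply/negPn/negP=> i'O.
  by have := i'O; rewrite (perm_inj (tout _ i'O)) iO.
case yE : (hgt h b t * (X ^+ k)^-1) => [[h' b'] t'].
have t'E : t' = (sO ^+ k)^-1 * t.
  by rewrite -XkP; exact: (esym (congr1 (fun z : HGt G n => sd_perm z) yE)).
have t'i i : t' i = if i \in O then i else t i.
  by rewrite t'E permM; case: ifP => [/tin //|/negbT/tout ->].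
apply: (IH h' b' t').
- rewrite -ltnS; apply: leq_trans tm; rewrite ltnS; apply: proper_card.
  apply/properP; split.
    by apply/subsetP=> i; rewrite !inE t'i; case: ifP => //; rewrite eqxx.
  by exists j; rewrite inE ?t'i ?porbit_id ?eqxx.
- apply/permP=> i; rewrite !permM !t'i sOO; case: ifP => // _.
  by rewrite -!permM ts.
- by move=> i; rewrite t'i; case: ifP => // _; exact: porbit_id.
- by rewrite -[hgt h' b' t']yE -mulgA Xkx mulgA E !mulgA.
Qed.
End Centralizer.

End Splitting.

(** * Normal-form cycles indexed by the parts of a pair of partition-valued functions *)

Lemma mult_part_eq N m (r : intpart) : sumn r <= N ->
  (forall i, 0 < i <= N -> m i = count_mem i r) -> mult_part N m = r.
Proof.
move=> rN E; apply/val_inj; apply: (sorted_eq (leT := geq)).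
- by move=> a b c ba ac; exact: leq_trans ac ba.
- by move=> i j; rewrite andbC => /anti_leq.
- by have /andP[] := part_seqP (mult_part N m).
- by have /andP[] := part_seqP r.
apply/allP=> i _; apply/eqP; have [iP|iP] := boolP (0 < i <= N).
  by rewrite count_mult_part // E.
(* Outside the range from 1 to [N] both multiplicities vanish: 0 is never a part, and no part of
   either partition exceeds [N]. *)
have notin (q : intpart) : (forall j, j \in part_seq q -> j <= N) -> count_mem i q = 0%N.
  move=> qN; apply/count_memPn/negP=> iq; move/negP: iP; apply.
  rewrite qN // andbT lt0n; apply/negP=> /eqP i0.
  by have /andP[_] := part_seqP q; rewrite -i0 iq.
rewrite !notin // => j.
  by move/(big_rem _) => S; rewrite (leq_trans _ rN) // sumnE S leq_addr.
case/flattenP=> q /mapP[l]; rewrite mem_rev mem_iota add1n ltnS.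
by move=> /andP[_ lN] -> /nseqP[->].
Qed.

Section Index.
Variables (G : finGroupType) (rp rm : {ffun conj_classes G -> intpart}).

Definition part_of (ce : conj_classes G * 'Z_2) : intpart :=
  if ce.2 == 0%R then rp ce.1 else rm ce.1.

(** Parts are indexed by position, so that repeated parts give distinct cycles. *)
Definition part_index := {ce : conj_classes G * 'Z_2 & 'I_(size (part_of ce))}.
Definition part_len (w : part_index) : nat := nth 0%N (part_of (tag w)) (tagged w).

Lemma part_len_gt0 w : 0 < part_len w.
Proof.
have /andP[_ r0] := part_seqP (part_of (tag w)).
rewrite lt0n; apply/negP=> /eqP w0; move/negP: r0; apply.
by rewrite -[X in X \in _]w0; apply: mem_nth; exact: ltn_ord.
Qed.

Lemma card_part_len ce i :
  #|[set w : part_index | (part_len w == i) && (tag w == ce)]| = count_mem i (part_of ce).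
Proof.
have -> : [set w : part_index | (part_len w == i) && (tag w == ce)] =
    Tagged (fun ce => 'I_(size (part_of ce))) @:
      [set j : 'I_(size (part_of ce)) | nth 0%N (part_of ce) j == i].
  apply/setP=> w; rewrite inE; apply/andP/imsetP => [[]|[j]].
    by case: w => ce' j /= + /eqP E; case: _ / E j => j jE; exists j; rewrite ?inE.
  by rewrite inE => ji ->.
rewrite card_imset; last first.
  move=> j j' E; apply: val_inj.
  exact: (congr1 (fun w : part_index => val (tagged w)) E).
rewrite -sum1_count (big_nth 0%N) big_mkord -sum1_card; apply: eq_bigl => j.
by rewrite inE.
Qed.

Lemma sum_part_index (F : conj_classes G * 'Z_2 -> nat -> nat) :
  \sum_(w : part_index) F (tag w) (part_len w) =
  \sum_c (\sum_(m <- rp c) F (c, 0%R) m + \sum_(m <- rm c) F (c, 1%R) m).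
Proof.
transitivity (\sum_ce \sum_(m <- part_of ce) F ce m).
  under [RHS]eq_bigr do rewrite (big_nth 0%N) big_mkord.
  by rewrite (sig_big_dep xpredT (fun _ => xpredT)
    (fun ce (j : 'I_(size (part_of ce))) => F ce (nth 0%N (part_of ce) j))).
rewrite (eq_bigr (fun ce => \sum_(m <- part_of (ce.1, ce.2)) F (ce.1, ce.2) m));
  last by case.
rewrite -(pair_bigA _ (fun c e => \sum_(m <- part_of (c, e)) F (c, e) m)) /=.
apply: eq_bigr => c _; rewrite big_ord_recl big_ord1.
by congr (_ + _); rewrite (_ : lift _ _ = 1%R) //; exact/val_inj.
Qed.

Lemma card_nf_index :
  #|{: {w : part_index & 'I_(part_len w)}}| = (pp_norm rp + pp_norm rm)%N.
Proof.
rewrite -sum1_card.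
rewrite -(sig_big_dep xpredT (fun _ => xpredT) (fun w (_ : 'I_(part_len w)) => 1%N)).
under eq_bigr do rewrite sum1_card card_ord.
rewrite (sum_part_index (fun _ m => m)) big_split /pp_norm.
by congr (_ + _)%N; apply: eq_bigr => c _; rewrite sumnE.
Qed.

Lemma card_minus : #|[set w : part_index | (tag w).2 == 1%R]| = pp_length rm.
Proof.
rewrite -sum1_card big_mkcond.
rewrite (eq_bigr (fun w => nat_of_bool ((tag w).2 == 1%R))); last first.
  by move=> w _; rewrite inE; case: (_ == _).
rewrite (sum_part_index (fun ce _ => nat_of_bool (ce.2 == 1%R))).
apply: eq_bigr => c _; rewrite big1 //= add0n -sum1_size.
by apply: eq_bigr.
Qed.

End Index.

(** * Two criteria in the double cover *)

Section Criteria.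
Variables (G : finGroupType) (n : nat).
Implicit Types (g h : {ffun 'I_n -> G}) (a b : Pin n) (s t : 'S_n).

(** Up to a power of z, [a] is a_p a_q a' with a' fixed by [t]. Then [t] turns a_p a_q into a_q a_p,
    so t(a) = z a, while [t] commutes with everything else in x. *)
Lemma swap_nonsplit g a s t p q :
  s * t = t * s -> (forall j, g (t j) = g j) -> p != q -> t p = q -> t q = p ->
  pin_vec a p = 1%R -> pin_vec a q = 1%R ->
  (forall j, j != p -> j != q -> pin_vec a j != 0%R -> t j = j) ->
  nonsplit (hgt g a s).
Proof.
move=> st gt pq tp tq ap aq tfix; exists (hgt 1 1 t); apply/eqP/HGt_commP.
split; rewrite ?mul1g //.
  apply/ffunP=> i; rewrite ffun_act_1r mulg1 ffunE.
  by rewrite -(gt (t^-1 i)) permKV.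
rewrite (pin_act_c s 0%R) mulg1.
have upq : uniq [:: p; q] by rewrite /= inE pq.
pose a' := PinElt [ffun j => if j \in [:: p; q] then 0%R else pin_vec a j] 0%R.
have [d ->] : exists d, a = pin_c n d * (pin_seq [:: p; q] * a').
  eexists; apply: pin_vec_inj; rewrite pin_vecM; apply/ffunP=> i.
  rewrite ffunE pin_seq_vec // [pin_vec a' i]ffunE.
  by case: ifP; rewrite ?add0r // !inE => /orP[] /eqP ->; rewrite addr0.
have ta' : pin_act t a' = a'.
  rewrite -[RHS]pin_act1; apply: pin_act_eq => i; rewrite ffunE perm1 !inE.
  by case: (eqVneq i p); case: (eqVneq i q); rewrite /= ?eqxx // => iq ip /tfix ->.
rewrite !pin_actM pin_act_c ta' pin_seq_act /= tp tq.
rewrite (pin_seq_rot (j := p) (r := [:: q])) ?upq //=.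
by rewrite !mulgA -!pin_cD addrC.
Qed.

Lemma odd_perm_order (T : finType) (s : {perm T}) : (forall j, odd #|porbit s j|) ->
  exists2 m, odd m & s ^+ m = 1.
Proof.
move=> so; exists (\prod_j #|porbit s j|)%N.
  by apply: (big_ind odd) => // m1 m2; rewrite oddM => -> ->.
apply/permP=> j; rewrite permX perm1; apply/eqP.
rewrite -[X in _ == X]/(iter 0 s j) eq_iter_porbit mod0n.
by rewrite (bigD1 j) //= modnMr.
Qed.

(** A commutator z would give s(b) = z b, hence s^m(b) = z^m b for all m. An odd m with s^m = 1 then
    yields b = z b. *)
Lemma odd_cycles_split g s : (forall j, odd #|porbit s j|) -> ~ nonsplit (hgt g 1 s).
Proof.
move=> /odd_perm_order[m om sm] [[[h b] t]] /eqP/HGt_commP[_ _].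
rewrite (pin_act_c t 0%R) mulg1 mul1g => E.
have sb : pin_act s b = pin_c n 1%R * b.
  by rewrite {2}E mulgA -pin_cD Z2_addxx mul1g.
have sk k : pin_act (s ^+ k) b = pin_c n k%:R%R * b.
  elim: k => [|k IH]; first by rewrite pin_act1 mul1g.
  rewrite expgSr pin_act_comp IH pin_actM pin_act_c sb mulgA -pin_cD.
  by rewrite [k.+1%:R%R]mulrS addrC.
have := sk m; rewrite sm pin_act1 -{1}[b]mul1g => /mulIg/pin_c_inj.
by rewrite -(odd_double_half m) om natrD -addnn natrD Z2_addxx.
Qed.

End Criteria.

(** * The criterion for the lifted normal form *)

Section Main.
Variables (G : finGroupType) (n : nat) (rp rm : {ffun conj_classes G -> intpart}).
Local Notation W := (part_index rp rm).
Local Notation lab := (fun w : W => tag w).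
Hypothesis norm : (pp_norm rp + pp_norm rm)%N = n.
Variables (f : 'I_n -> {w : W & 'I_(part_len w)}) (f' : {w : W & 'I_(part_len w)} -> 'I_n).
Hypotheses (fK : cancel f f') (f'K : cancel f' f).

Let w_gt0 := @part_len_gt0 G rp rm.
Let k := nf_ker lab f.
Let s := nf_perm fK f'K.
Let x := nf lab fK f'K.
Let base := nf_base w_gt0 f'.
Let g := [ffun j => (k j).1].
Let a := PinElt [ffun j => (k j).2] 0%R.
Definition nf_lift : HGt G n := hgt g a s.

Lemma theta_lift : theta nf_lift = x.
Proof.
congr Semidirect; apply/ffunP=> j; rewrite [LHS]ffunE /=.
by rewrite [X in (X, _)]ffunE [X in (_, X)]ffunE -surjective_pairing.
Qed.

Lemma htype_nf : htype x = (rp, rm).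
Proof.
have le_norm (rho : {ffun conj_classes G -> intpart}) c : sumn (rho c) <= pp_norm rho.
  by rewrite /pp_norm (bigD1 c) //= leq_addr.
congr (_, _); apply/ffunP=> c; rewrite ffunE; apply: mult_part_eq => [|i iP].
- by rewrite (leq_trans (le_norm _ _)) // -norm leq_addr.
- by rewrite (cycle_mult_nf lab w_gt0 fK f'K) card_part_len.
- by rewrite (leq_trans (le_norm _ _)) // -norm leq_addl.
- by rewrite (cycle_mult_nf lab w_gt0 fK f'K) card_part_len.
Qed.

Lemma parity_lift : wt (pin_vec a) = (pp_length rm)%:R%R.
Proof.
by rewrite -(parity_theta g a s) theta_lift (parity_nf lab w_gt0) card_minus.
Qed.

Lemma sgn_lift w : (\sum_(i in porbit s (base w)) pin_vec a i)%R = (tag w).2.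
Proof.
rewrite -(cycle_sgn_theta g a s) theta_lift.
by have := label_nf lab w_gt0 fK f'K w; case.
Qed.

Lemma card_lift w : #|porbit s (base w)| = part_len w.
Proof. by rewrite card_nf_porbit // nf_cycle_base. Qed.

(** For a positive cycle the commutator with [cycle_a] has exponent m (p + 1) + 1, so it is z when p
    is odd or m is even. *)
Lemma nonsplit_plus (w : W) : (tag w).2 = 0%R ->
  ((part_len w)%:R * ((pp_length rm)%:R + 1) = 0 :> 'Z_2)%R -> nonsplit nf_lift.
Proof.
move=> w0 E; exists (cycle_a G s (base w)); rewrite cycle_a_comm.
by rewrite card_lift sgn_lift parity_lift w0 E add0r addr0.
Qed.

(** Here the exponent e (p + 1) of [cycle_part] has e = 1 and p = 0. *)
Lemma nonsplit_minus_even (w : W) : (tag w).2 = 1%R ->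
  ((pp_length rm)%:R = 0 :> 'Z_2)%R -> nonsplit nf_lift.
Proof.
move=> w1 E; exists (cycle_part g a s (porbit s (base w))); rewrite cycle_part_comm.
  by rewrite sgn_lift parity_lift w1 E mul1r add0r.
by move=> i; rewrite -!eq_porbit_mem (porbit_iter s 1 i).
Qed.

(** As all signs sit on base points, exchanging the two cycles point by point exchanges just two
    generators of [a] and fixes the others. *)
Lemma nonsplit_repeated (w1 w2 : W) : w1 != w2 -> (tag w1).2 = 1%R ->
  tag w1 = tag w2 -> part_len w1 = part_len w2 -> nonsplit nf_lift.
Proof.
move=> w12 sg1 tE lE; pose sg := tperm w1 w2.
have sglen w : part_len (sg w) = part_len w by rewrite /sg; case: tpermP => [->|->|].
have sglab w : tag (sg w) = tag w by rewrite /sg; case: tpermP => [->|->|].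
have [t [ts tP]] := nf_permute w_gt0 fK f'K sglen.
have kt j : k (t j) = k j.
  by have [c p] := tP j; rewrite !ffunE c p sglab.
have tbase w : t (base w) = base (sg w).
  have [c p] := tP (base w); apply: (nf_inj fK); rewrite ?c ?p.
    by rewrite /base !nf_cycle_base.
  by rewrite /base !nf_pos_base.
have abase w : pin_vec a (base w) = (tag w).2.
  by rewrite ffunE ffunE nf_pos_base // /base nf_cycle_base.
apply: (@swap_nonsplit _ _ _ _ _ t (base w1) (base w2)).
- by apply/permP=> j; rewrite !permM ts.
- by move=> j; rewrite ffunE [RHS]ffunE kt.
- apply: contraNneq w12 => bE.
  by rewrite -(nf_cycle_base w_gt0 f'K w1) -/base bE /base nf_cycle_base.
- by rewrite tbase /sg tpermL.
- by rewrite tbase /sg tpermR.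
- by rewrite abase.
- by rewrite abase -tE.
move=> j j1 j2; rewrite ffunE => /(nf_ker_base w_gt0 fK) jE.
have -> : t j = base (sg (nf_cycle f j)) by rewrite -tbase /base -jE.
rewrite /sg tpermD; first by rewrite /base -jE.
  by apply: contraNneq j1 => ->; rewrite {1}jE.
by apply: contraNneq j2 => ->; rewrite {1}jE.
Qed.

Lemma split_even : rm = pp_empty (conj_classes G) -> (forall c, all odd (rp c)) ->
  ~ nonsplit nf_lift.
Proof.
move=> rm0 rp_odd.
have plus (w : W) : (tag w).2 = 0%R.
  case: w => [[c e] i] /=; case: (eqVneq e 0%R) => // e1.
  have c0 : size (part_of rp rm (c, e)) = 0%N by rewrite /part_of /= (negPf e1) rm0 ffunE.
  by have := ltn_ord i; rewrite [X in _ < X]c0.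
have a1 : a = pin_c n 0%R.
  by congr PinElt; apply/ffunP=> j; rewrite ffunE ffunE [RHS]ffunE /= plus; case: ifP.
rewrite /nf_lift a1; apply: odd_cycles_split => j.
rewrite -(nf_iter_base w_gt0 fK f'K j) porbit_iter card_lift /part_len.
set w := nf_cycle f j; have := plus w; case: w => [[c e] i] /= e0.
have /(all_nthP 0%N) : all odd (part_of rp rm (c, e)) by rewrite /part_of /= e0 rp_odd.
by apply; exact: ltn_ord.
Qed.

Lemma split_odd : rp = pp_empty (conj_classes G) -> (forall c, uniq (rm c)) ->
  ((pp_length rm)%:R = 1 :> 'Z_2)%R -> ~ nonsplit nf_lift.
Proof.
move=> rp0 rm_uniq p1 [y yx].
have minus (w : W) : (tag w).2 = 1%R.
  case: w => [[c e] i] /=; case: (eqVneq e 0%R) => [e0|].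
    have c0 : size (part_of rp rm (c, e)) = 0%N by rewrite /part_of /= e0 rp0 ffunE.
    by have := ltn_ord i; rewrite [X in _ < X]c0.
  by case: e {i} => [[|[|//]] eP] // _; exact/val_inj.
have thc : theta y * x = x * theta y.
  by rewrite -theta_lift -!thetaM yx thetaM theta_c mul1g.
(* Strictness makes a cycle recoverable from its label and length. *)
have w_inj (w w' : W) : tag w = tag w' -> part_len w = part_len w' -> w = w'.
  have := minus w; case: w w' => [ce i] [ce' i'] /= ce1 E; case: ce' / E i' => i'.
  rewrite /part_len /= => /eqP; rewrite nth_uniq ?ltn_ord //.
    by move/eqP/val_inj => ->.
  by rewrite /part_of ce1 rm_uniq.
case: y yx thc => [[h b] t]; rewrite -/(hgt h b t) => yx thc.
have [st _ _] := HGt_commP _ _ _ _ _ _ _ (introT eqP yx).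
suff /(@esym _ _ _) : 1%R = 0%R :> 'Z_2 by [].
apply: (odd_commutator _ _ _ _ yx); rewrite ?parity_lift //.
  by move=> j; rewrite -(nf_iter_base w_gt0 fK f'K j) porbit_iter sgn_lift minus.
move=> j; rewrite (mem_nf_porbit w_gt0); apply/eqP.
have jE i : porbit s i = porbit s (base (nf_cycle f i)).
  by rewrite -{1}(nf_iter_base w_gt0 fK f'K i) porbit_iter.
have ts i : t (s i) = s (t i) by rewrite -!permM st.
(* The image of [y] centralizes the normal form, so [t] carries each cycle to one with the same
   label, that is, to itself. *)
have := label_transport j thc; rewrite /= -(transport_porbit ts) (jE (t j)) (jE j).
rewrite !(label_nf lab w_gt0) => -[E1 E2 E3]; apply: w_inj => //.
move: E2 E3; case: (tag _) => c e; case: (tag _) => c' e' /= -> /val_inj -> //.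
Qed.

End Main.

(** * The criterion for an arbitrary type *)

Section Criterion.
Variables (G : finGroupType) (n : nat) (rp rm : {ffun conj_classes G -> intpart}).
Hypothesis norm : (pp_norm rp + pp_norm rm)%N = n.

Let card_T : #|{: {w : part_index rp rm & 'I_(part_len w)}}| = n.
Proof. by rewrite card_nf_index. Qed.

Let f (j : 'I_n) := enum_val (cast_ord (esym card_T) j).
Let f' p := cast_ord card_T (enum_rank p).
Let fK : cancel f f'. Proof. by move=> j; rewrite /f /f' enum_valK cast_ordKV. Qed.
Let f'K : cancel f' f. Proof. by move=> p; rewrite /f /f' cast_ordK enum_rankK. Qed.
Let x := nf_lift fK f'K.

Lemma htype_lift : htype (theta x) = (rp, rm).
Proof. by rewrite theta_lift htype_nf. Qed.

Let part_at c e i (ic : i < size (part_of rp rm (c, e))) : part_index rp rm :=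
  Tagged (fun ce => 'I_(size (part_of rp rm ce))) (Ordinal ic).

(** The class is nonempty, as it contains the normal form, whose parity is the number of negative
    cycles. *)
Lemma parity_class e : {in type_class n rp rm, forall y, parity y = e} ->
  ((pp_length rm)%:R = e)%R.
Proof.
move=> /(_ (theta x)); rewrite inE htype_lift eqxx parity_theta (parity_lift fK f'K).
by apply.
Qed.

Lemma even_criterion : even_class (type_class n rp rm) ->
  class_splits (type_class n rp rm) <-> OP n rp /\ rm = pp_empty (conj_classes G).
Proof.
move=> /'forall_implyP ev.
have p0 : ((pp_length rm)%:R = 0 :> 'Z_2)%R.
  by apply: parity_class => y /ev /eqP.
rewrite (class_splitsP htype_lift); split=> [ns|[/andP[_ /forallP rp_odd] rm0]].
  have rm0 : rm = pp_empty (conj_classes G).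
    apply/ffunP=> c; rewrite ffunE; apply/val_inj/size0nil/eqP; rewrite -leqn0 leqNgt.
    apply/negP=> c0; apply: ns.
    exact: (@nonsplit_minus_even _ _ _ _ _ _ fK f'K (@part_at c 1%R 0 c0)).
  split=> //; apply/andP; split.
    rewrite -norm rm0 [pp_norm (pp_empty _)]big1 ?addn0 // => c _; by rewrite ffunE.
  apply/forallP=> c; apply/(all_nthP 0%N) => i ic; apply/negPn/negP=> ev_i; apply: ns.
  (* With p = 0 the condition m (p + 1) = 0 says that the offending part is even. *)
  apply: (@nonsplit_plus _ _ _ _ _ _ fK f'K (@part_at c 0%R i ic)) => //.
  rewrite p0 add0r mulr1 -(odd_double_half (part_len _)) (negPf ev_i) add0n.
  by rewrite -addnn natrD Z2_addxx.
exact: split_even.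
Qed.

Lemma odd_criterion : odd_class (type_class n rp rm) ->
  class_splits (type_class n rp rm) <-> rp = pp_empty (conj_classes G) /\ SPminus n rm.
Proof.
move=> /'forall_implyP od.
have p1 : ((pp_length rm)%:R = 1 :> 'Z_2)%R.
  by apply: parity_class => y /od /eqP.
rewrite (class_splitsP htype_lift).
split=> [ns|[rp0 /andP[/andP[_ /forallP rm_uniq] _]]]; last exact: split_odd.
have rp0 : rp = pp_empty (conj_classes G).
  apply/ffunP=> c; rewrite ffunE; apply/val_inj/size0nil/eqP; rewrite -leqn0 leqNgt.
  apply/negP=> c0; apply: ns.
  (* With p = 1 the factor p + 1 vanishes, so a positive cycle of any length is an obstruction. *)
  apply: (@nonsplit_plus _ _ _ _ _ _ fK f'K (@part_at c 0%R 0 c0)) => //.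
  by rewrite p1 Z2_addxx mulr0.
split=> //; apply/andP; split; last first.
  apply/negPn/negP=> /negPf ev; move: p1.
  by rewrite -(odd_double_half (pp_length rm)) ev add0n -addnn natrD Z2_addxx.
apply/andP; split.
  rewrite -norm rp0 [pp_norm (pp_empty _)]big1 // => c _; by rewrite ffunE.
apply/forallP=> c; apply/(uniqP 0%N) => i j ic jc ij.
apply/eqP/negPn/negP=> nij; apply: ns.
apply: (@nonsplit_repeated _ _ _ _ _ _ fK f'K
  (@part_at c 1%R i ic) (@part_at c 1%R j jc)) => //.
by apply: contraNneq nij => /(congr1 (fun w : part_index rp rm => val (tagged w))) /= ->.
Qed.

End Criterion.

Theorem theorem1p2 (G : finGroupType) (n : nat)
    (rp rm : {ffun conj_classes G -> intpart}) :
  (pp_norm rp + pp_norm rm)%N = n ->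
  (even_class (type_class n rp rm) ->
     (class_splits (type_class n rp rm) <->
        OP n rp /\ rm = pp_empty (conj_classes G))) /\
  (odd_class (type_class n rp rm) ->
     (class_splits (type_class n rp rm) <->
        rp = pp_empty (conj_classes G) /\ SPminus n rm)).
Proof. by move=> norm; split; [exact: even_criterion | exact: odd_criterion]. Qed.
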